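(* Let $k$ be a fixed positive integer. There is a constant $C_k>0$ (depending only on $k$) such that for every Johnson graph $J(n,k)$, with $N=\binom{n}{k}$ vertices and Laplacian matrix $L$, there is a quantum search algorithm whose parameters depend only on $n$ and $k$ (not on the marked vertex) and which, for every marked vertex $m$, deterministically (with success probability exactly $1$) finds $m$ using at most $C_k\sqrt N$ calls to the search operator $e^{-i\theta|m\rangle\langle m|}$. Concretely, starting from $|s\rangle=\frac{1}{\sqrt N}\sum_{v}|v\rangle$, the algorithm applies a sequence of continuous-time quantum walk operators $e^{-iLt}$ ($t\in\mathbb R$) alternated with search operators $e^{-i\theta|m\rangle\langle m|}$ ($\theta\in\mathbb R$) and produces the state $|m\rangle$ up to a global phase.
   Context: The Johnson graph $J(n,k)$ has as vertices the $k$-element subsets of $\{1,\dots,n\}$, two vertices being adjacent when their intersection has size $k-1$. The Laplacian is $L=D-A$ with $D$ the diagonal degree matrix and $A$ the adjacency matrix. States live in the Hilbert space spanned by the orthonormal vertex basis $\{|v\rangle\}$; the marked vertex $m$ is accessible only through the search operator $e^{-i\theta|m\rangle\langle m|}$. *)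

(* Defs.v *)
From HB Require Import structures.
From mathcomp Require Import all_boot all_order all_algebra.
From mathcomp Require Import all_classical all_reals.
From mathcomp Require Import topology normedtype sequences.
From mathcomp Require Import complex.
Set Implicit Arguments. Unset Strict Implicit. Unset Printing Implicit Defensive.
Import Order.TTheory GRing.Theory Num.Theory numFieldNormedType.Exports.
Local Open Scope ring_scope.
Local Open Scope complex_scope.

Notation jvertex n k := {A : {set 'I_n} | #|A| == k}.

Definition jadj (n k : nat) (v w : jvertex n k) : bool :=
  #|val v :&: val w| == k.-1.

Notation jN n k := #|{: jvertex n k}|.

Definition jdeg (n k : nat) (v : jvertex n k) : nat := #|[pred w | jadj v w]|.

Section Quantum.
Context {R : realType}.

Definition jlaplacian (n k : nat) : 'M[R[i]]_(jN n k) :=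
  \matrix_(i, j) ((if i == j then (jdeg (enum_val i))%:R else 0)
                  - (jadj (enum_val i) (enum_val j))%:R).

Definition expmx_psum (N : nat) (A : 'M[R[i]]_N) (M : nat) : 'M[R[i]]_N :=
  \sum_(l < M) ((l`!)%:R)^-1 *: A ^+ l.

Definition expmx (N : nat) (A : 'M[R[i]]_N) : 'M[R[i]]_N :=
  \matrix_(i, j) ((limn (fun M => complex.Re (expmx_psum A M i j)))
                  +i* (limn (fun M => complex.Im (expmx_psum A M i j)))).

Definition walk_op (n k : nat) (t : R) : 'M[R[i]]_(jN n k) :=
  expmx ((- ('i * t%:C)) *: jlaplacian n k).

Definition ket (N : nat) (m : 'I_N) : 'cV[R[i]]_N := delta_mx m 0.

Definition search_op (N : nat) (m : 'I_N) (theta : R) : 'M[R[i]]_N :=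
  expmx ((- ('i * theta%:C)) *: (ket m *m (ket m)^T)).

Definition unif_state (N : nat) : 'cV[R[i]]_N :=
  const_mx ((Num.sqrt (N%:R : R))^-1)%:C.

(* The algorithm with parameters t0 and ps = [(theta_1,t_1);...;(theta_p,t_p)]:
   e^{-iL t_p} S(theta_p) ... e^{-iL t_1} S(theta_1) e^{-iL t_0} |s>,
   where S(theta) = e^{-i theta |m><m|}; it makes size ps oracle calls. *)
Definition search_run (n k : nat) (t0 : R) (ps : seq (R * R))
    (m : jvertex n k) : 'cV[R[i]]_(jN n k) :=
  foldl (fun psi p => walk_op n k p.2 *m (search_op (enum_rank m) p.1 *m psi))
        (walk_op n k t0 *m unif_state (jN n k)) ps.

End Quantum.

(* Main.v *)
(** Let [Z = e^(-iLt)], let [jeig l = l (n + 1 - l)], [l <= k], be the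
    eigenvalues of [L], and [z_l = e^(-it jeig l)].  As [L - jeig j] maps the
    span of the functions [B |-> (T \subset B)], [#|T| = j], into the same span
    for [j - 1], the product of the [Z - z_l], [1 <= l <= k], sends [|m>] to
    [\prod_l (1 - z_l) / sqrt N] times [|s>].

    Apply these factors one at a time, normalizing: [x_0 = |m>] and
    [x_(r+1) = (Z - z_l) x_r / delta_r].  If a word [U] with [c] oracle calls
    maps [x_r] to [|m>], conjugating the oracle by [U] and by [U Z^-1] gives the
    phase rotations about [x_r] and [Z x_r] for [2 c + 1] calls each.  Both
    vectors span a plane containing [x_(r+1)]; with [w] the angle between them,
    [x_(r+1)] lies at an angle [x] from [x_r] with [sin x = sin w / delta_r], so
    [O(x / w) = O(1 / delta_r)] Grover steps, followed by one step with a tuned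
    phase, map [x_(r+1)] exactly to [x_r].  The costs multiply up to
    [O(1 / \prod_r delta_r)], and [\prod_r delta_r] is the norm
    [\prod_l |1 - z_l| / sqrt N].  For [t = 1 / (2 k (n + 1))] the [|1 - z_l|] are
    bounded below in terms of [k] alone, and [Z] is so close to the identity
    that [w < pi / 4].  Permutations of the [n] points carry the word found
    for one vertex to every other vertex, so its parameters do not depend on
    the vertex. *)
Require Import Defs.
From HB Require Import structures.
From mathcomp Require Import all_boot all_order all_algebra.
From mathcomp Require Import all_classical all_reals.
From mathcomp Require Import topology normedtype sequences.
From mathcomp Require Import complex.
From mathcomp Require Import perm derive trigo spectral.
From mathcomp Require Import zify ring lra.
Set Implicit Arguments. Unset Strict Implicit. Unset Printing Implicit Defensive.
Import Order.TTheory GRing.Theory Num.Theory numFieldNormedType.Exports.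
Local Open Scope ring_scope.
Local Open Scope complex_scope.
Local Notation "z ^*" := (Num.conj z) : complex_scope.

(** * Exponentials of diagonalizable matrices *)

Definition adjmx {R : realType} {p q} (A : 'M[R[i]]_(p, q)) : 'M[R[i]]_(q, p) :=
  \matrix_(i, j) Num.conj (A j i).

Definition expi {R : realType} (a : R) : R[i] := cos a +i* sin a.
Arguments expi : simpl never.

Section Expmx.
Context {R : realType}.
Implicit Types (a b : R) (z : R[i]).

Lemma adjmxE p q (A : 'M[R[i]]_(p, q)) : adjmx A = map_mx (@Num.conj R[i]) A^T.
Proof. by apply/matrixP => i j; rewrite !mxE. Qed.

Lemma adjmxK p q (A : 'M[R[i]]_(p, q)) : adjmx (adjmx A) = A.
Proof. by apply/matrixP => i j; rewrite !mxE conjCK. Qed.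

Lemma adjmxM p q r (A : 'M[R[i]]_(p, q)) (B : 'M[R[i]]_(q, r)) :
  adjmx (A *m B) = adjmx B *m adjmx A.
Proof. by rewrite !adjmxE trmx_mul map_mxM. Qed.

Lemma expiD a b : expi (a + b) = expi a * expi b.
Proof. by rewrite /expi cosD sinD; simpc; rewrite (addrC (sin a * cos b)). Qed.

Lemma expi0 : expi (0 : R) = 1.
Proof. by rewrite /expi cos0 sin0. Qed.

Lemma conjCR a : (a%:C)^* = a%:C :> R[i].
Proof. exact: conjc_real. Qed.

Lemma expiN a : expi (- a) = (expi a)^*.
Proof. by rewrite /expi cosN sinN. Qed.

Lemma expi_mulVc a : expi (- a) * expi a = 1.
Proof. by rewrite -expiD addNr expi0. Qed.

Lemma norm_expi a : `|expi a| = 1.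
Proof. by rewrite normc_def /= cos2Dsin2 sqrtr1. Qed.

(** Convergence is split into real and imaginary parts because [expmx] takes its limits that way. *)
Definition ccvg (u : nat -> R[i]) z :=
  (((fun n => complex.Re (u n)) @ \oo --> complex.Re z) /\
   ((fun n => complex.Im (u n)) @ \oo --> complex.Im z))%classic.

Lemma ccvg_cst z : ccvg (fun=> z) z.
Proof. by split; exact: cvg_cst. Qed.

Lemma ccvgD u v z1 z2 : ccvg u z1 -> ccvg v z2 ->
  ccvg (fun n => u n + v n) (z1 + z2).
Proof.
move=> [hu hu'] [hv hv']; split.
  rewrite (_ : complex.Re (z1 + z2) = complex.Re z1 + complex.Re z2); last first.
    by case: z1 z2 {hu hu' hv hv'} => [? ?] [].
  rewrite (_ : (fun n => _) =
      (fun n => complex.Re (u n) + complex.Re (v n))); first exact: cvgD.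
  by apply/funext => n; case: (u n) (v n) => [? ?] [].
rewrite (_ : complex.Im (z1 + z2) = complex.Im z1 + complex.Im z2); last first.
  by case: z1 z2 {hu hu' hv hv'} => [? ?] [].
rewrite (_ : (fun n => _) =
    (fun n => complex.Im (u n) + complex.Im (v n))); first exact: cvgD.
by apply/funext => n; case: (u n) (v n) => [? ?] [].
Qed.

Lemma ccvgM u v z1 z2 : ccvg u z1 -> ccvg v z2 ->
  ccvg (fun n => u n * v n) (z1 * z2).
Proof.
move=> [hu hu'] [hv hv']; split.
  rewrite (_ : complex.Re (z1 * z2) = complex.Re z1 * complex.Re z2 -
     complex.Im z1 * complex.Im z2); last first.
    by case: z1 z2 {hu hu' hv hv'} => [? ?] [].
  rewrite (_ : (fun n => _) = (fun n => complex.Re (u n) * complex.Re (v n) -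
      complex.Im (u n) * complex.Im (v n))).
    by apply: cvgB; exact: cvgM.
  by apply/funext => n; case: (u n) (v n) => [? ?] [].
rewrite (_ : complex.Im (z1 * z2) = complex.Re z1 * complex.Im z2 +
   complex.Im z1 * complex.Re z2); last first.
  by case: z1 z2 {hu hu' hv hv'} => [? ?] [].
rewrite (_ : (fun n => _) = (fun n => complex.Re (u n) * complex.Im (v n) +
    complex.Im (u n) * complex.Re (v n))).
  by apply: cvgD; exact: cvgM.
by apply/funext => n; case: (u n) (v n) => [? ?] [].
Qed.

Lemma ccvg_sum (I : Type) (s : seq I) (u : I -> nat -> R[i]) (z : I -> R[i]) :
  (forall j, ccvg (u j) (z j)) ->
  ccvg (fun n => \sum_(j <- s) u j n) (\sum_(j <- s) z j).
Proof.
move=> h; elim: s => [|j s ih].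
  rewrite big_nil (_ : (fun n => _) = fun=> 0); first exact: ccvg_cst.
  by apply/funext => n; rewrite big_nil.
rewrite big_cons (_ : (fun n => _) = (fun n => u j n + \sum_(j <- s) u j n)).
  exact: ccvgD.
by apply/funext => n; rewrite big_cons.
Qed.

(** The powers of ['i] sort the exponential series by parity: the real parts of its partial sums are
    those of the cosine series, the imaginary parts those of the sine series. *)
Lemma ccvg_expi a :
  ccvg (fun M => \sum_(l < M) (l`!%:R)^-1 * ('i * a%:C) ^+ l) (expi a).
Proof.
(* The parity factors reproduce the shape of [cos_coeff] and [sin_coeff]; at [l = 0] the truncated
   [l.-1] is harmless, its term being multiplied by [0]. *)
have ipow l : ('i * a%:C : R[i]) ^+ l =
    ((~~ odd l)%:R * (-1) ^+ l./2 * a ^+ l) +i*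
    ((odd l)%:R * (-1) ^+ l.-1./2 * a ^+ l).
  have i2 : ('i : R[i]) ^+ 2 = - 1 by rewrite sqr_i.
  have ci b : 'i * b%:C = 0 +i* b by simpc.
  rewrite exprMn -rmorphXn /= -{1}(odd_double_half l) exprD -mul2n exprM i2.
  have -> : (-1 : R[i]) ^+ l./2 = ((-1) ^+ l./2)%:C.
    by rewrite rmorphXn rmorphN rmorph1.
  case: (boolP (odd l)) => /= ol.
    rewrite (_ : l.-1./2 = l./2); last first.
      by case: l ol => //= l ol; rewrite uphalf_half (negbTE ol).
    by rewrite !mul1r !mul0r expr1 -mulrA -rmorphM /= ci.
  by rewrite !mul1r !mul0r -rmorphM.
have fac l : (l`!%:R : R[i])^-1 = ((l`!%:R)^-1)%:C.
  by rewrite fmorphV rmorph_nat.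
have mulre (r : R) (x y : R) : r%:C * (x +i* y) = (r * x) +i* (r * y).
  by simpc.
split => /=.
  rewrite (_ : (fun n => _) = series (cos_coeff a)).
    by rewrite unlock; exact: is_cvg_series_cos_coeff.
  apply/funext => M; rewrite /series /= big_mkord.
  elim: M => [|M ih]; first by rewrite !big_ord0.
  rewrite !big_ord_recr /= -ih ipow fac mulre.
  by case: (\sum_(_ < _) _) => x y /=; rewrite [in LHS]mulrC.
rewrite (_ : (fun n => _) = series (sin_coeff a)).
  by rewrite unlock; exact: is_cvg_series_sin_coeff.
apply/funext => M; rewrite /series /= big_mkord.
elim: M => [|M ih]; first by rewrite !big_ord0.
rewrite !big_ord_recr /= -ih ipow fac mulre.
by case: (\sum_(_ < _) _) => x y /=; rewrite [in LHS]mulrC.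
Qed.

Lemma expmx_cvg N (A B : 'M[R[i]]_N) :
  (forall i j, ccvg (fun M => expmx_psum A M i j) (B i j)) -> expmx A = B.
Proof.
move=> h; apply/matrixP => i j; rewrite mxE.
have [/cvg_lim hr /cvg_lim hi] := h i j.
by rewrite hr // hi //; case: (B i j).
Qed.

(** Powers of a unitarily conjugated diagonal matrix stay of that form, so each entry of a partial
    sum is a finite combination of scalar exponential series, and [ccvg_expi] applies termwise. *)
Lemma expmx_diag N (Q : 'M[R[i]]_N) (d : 'I_N -> R) :
  Q *m adjmx Q = 1%:M ->
  expmx (adjmx Q *m diag_mx (\row_j ('i * (d j)%:C)) *m Q) =
  adjmx Q *m diag_mx (\row_j expi (d j)) *m Q.
Proof.
move=> QQ.
have QQ' : adjmx Q *m Q = 1%:M by apply: mulmx1C.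
have pw l : (adjmx Q *m diag_mx (\row_j ('i * (d j)%:C)) *m Q) ^+ l =
    adjmx Q *m diag_mx (\row_j ('i * (d j)%:C) ^+ l) *m Q.
  elim: l => [|l ih].
    rewrite expr0 (_ : diag_mx _ = 1%:M) ?mulmx1 ?QQ' //.
    by apply/matrixP => i j; rewrite !mxE expr0.
  rewrite exprS ih -[_ * _]/(_ *m _) !mulmxA -[_ *m Q *m adjmx Q]mulmxA QQ mulmx1.
  rewrite -[_ *m diag_mx _ *m diag_mx _]mulmxA mulmx_diag; congr (_ *m _ *m _).
  by congr diag_mx; apply/rowP => j; rewrite !mxE exprS.
have entry (w : 'I_N -> R[i]) i j :
    (adjmx Q *m diag_mx (\row_j w j) *m Q) i j = \sum_k adjmx Q i k * w k * Q k j.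
  by rewrite mxE; apply: eq_bigr => k _; rewrite mul_mx_diag !mxE.
apply: expmx_cvg => i j; rewrite entry.
rewrite (_ : (fun M => _) = (fun M => \sum_k adjmx Q i k *
   (\sum_(l < M) (l`!%:R)^-1 * ('i * (d k)%:C) ^+ l) * Q k j)).
  apply: ccvg_sum => k; apply: ccvgM; last exact: ccvg_cst.
  by apply: ccvgM; [exact: ccvg_cst|exact: ccvg_expi].
apply/funext => M; rewrite /expmx_psum summxE.
under eq_bigr do rewrite mxE pw entry mulr_sumr.
rewrite exchange_big /=; apply: eq_bigr => k _.
by rewrite mulr_sumr mulr_suml; apply: eq_bigr => l _; ring.
Qed.

End Expmx.

(** * Words in the walk and the oracle *)

Section Unimodular.
Context {R : realType}.
Implicit Types (z w : R[i]).

Lemma mulJ z : z^* * z = `|z| ^+ 2.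
Proof. by rewrite normCK mulrC. Qed.

Lemma unimodJ z : `|z| = 1 -> z^* * z = 1.
Proof. by rewrite mulJ => ->; rewrite expr1n. Qed.

Lemma unimod_expi z : `|z| = 1 -> exists a : R, z = expi a.
Proof.
rewrite normc_def; case: z => a b /= [] h.
have ab : a ^+ 2 + b ^+ 2 = 1.
  by rewrite -[RHS](expr1n _ 2) -h sqr_sqrtr // addr_ge0 ?sqr_ge0.
have a1 : -1 <= a <= 1.
  by rewrite -ler_norml -(@ler_pXn2r _ 2) ?nnegrE // real_normK ?num_real //; nra.
have b2 : 1 - a ^+ 2 = b ^+ 2 by rewrite -ab; ring.
have ca : cos (acos a) = a by apply: acosK; rewrite in_itv.
have sa : sin (acos a) = `|b| by rewrite sin_acos // b2 sqrtr_sqr.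
have [b0|b0] := lerP 0 b.
  by exists (acos a); rewrite /expi ca sa ger0_norm.
by exists (- acos a); rewrite /expi cosN sinN ca sa ltr0_norm // opprK.
Qed.

Lemma eq_norm_expi z w : `|z| = `|w| -> exists a : R, z = expi a * w.
Proof.
have [->|w0 h] := eqVneq w 0.
  by rewrite normr0 => /normr0_eq0 ->; exists 0; rewrite mulr0.
have [|a ha] := @unimod_expi (z / w).
  by rewrite normrM normfV h divff // normr_eq0.
by exists a; rewrite -ha divfK.
Qed.

End Unimodular.

(** * The Hermitian inner product *)

Section Dot.
Context {R : realType} {N : nat}.
Implicit Types (u v w : 'cV[R[i]]_N) (z : R[i]).

Definition dot u v : R[i] := (adjmx u *m v) 0 0.

Lemma dotE u v : dot u v = \sum_i (u i 0)^* * v i 0.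
Proof. by rewrite /dot mxE; apply: eq_bigr => i _; rewrite !mxE. Qed.

Lemma dotDr u v w : dot u (v + w) = dot u v + dot u w.
Proof. by rewrite /dot mulmxDr mxE. Qed.

Lemma dotZr u v z : dot u (z *: v) = z * dot u v.
Proof. by rewrite /dot -scalemxAr mxE. Qed.

Lemma dotC u v : dot u v = (dot v u)^*.
Proof.
rewrite !dotE rmorph_sum; apply: eq_bigr => i _.
by rewrite rmorphM /= conjCK mulrC.
Qed.

Lemma dotDl u v w : dot (u + v) w = dot u w + dot v w.
Proof. by rewrite dotC dotDr rmorphD /= -!dotC. Qed.

Lemma dotZl u v z : dot (z *: u) v = z^* * dot u v.
Proof. by rewrite dotC dotZr rmorphM /= -dotC. Qed.

Lemma dotM (A : 'M[R[i]]_N) u v : dot u (A *m v) = dot (adjmx A *m u) v.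
Proof. by rewrite /dot adjmxM adjmxK mulmxA. Qed.

Lemma outer_mulmx u v w : u *m adjmx v *m w = dot v w *: u.
Proof.
rewrite -mulmxA (_ : adjmx v *m w = (dot v w)%:M) ?mul_mx_scalar //.
by rewrite [LHS]mx11_scalar.
Qed.

(** Provides norms as elements of [R], so that later estimates are real inequalities. *)
Lemma dot_norm_real u : exists2 r : R, 0 <= r & dot u u = (r ^+ 2)%:C.
Proof.
pose r2 := \sum_i (complex.Re (u i 0) ^+ 2 + complex.Im (u i 0) ^+ 2).
have r2ge : 0 <= r2 by apply: sumr_ge0 => i _; rewrite addr_ge0 ?sqr_ge0.
exists (Num.sqrt r2); first exact: sqrtr_ge0.
rewrite sqr_sqrtr // /r2 rmorph_sum dotE; apply: eq_bigr => i _ /=.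
by rewrite mulJ add_Re2_Im2.
Qed.

Lemma dot_eq0 u : dot u u = 0 -> u = 0.
Proof.
rewrite dotE => h; apply/colP => i; rewrite !mxE.
have /eqP := h; rewrite psumr_eq0; last first.
  by move=> j _; rewrite mulJ exprn_ge0.
move=> /allP /(_ i); rewrite mem_index_enum => /(_ isT) /=.
by rewrite mulJ expf_eq0 /= normr_eq0 => /eqP.
Qed.

End Dot.

Section Words.
Context {R : realType} {N : nat}.
Implicit Types (A B : 'M[R[i]]_N) (x y u v : 'cV[R[i]]_N) (a t : R).

(** For a unit vector [x] this is the phase rotation [e^(-i a |x><x|)], in closed form because
    [|x><x|] is a projection. *)
Definition rot x a : 'M[R[i]]_N := 1%:M + (expi (- a) - 1) *: (x *m adjmx x).

Lemma rot_mulmx x a v : rot x a *m v = v + ((expi (- a) - 1) * dot x v) *: x.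
Proof. by rewrite mulmxDl mul1mx -scalemxAl outer_mulmx scalerA. Qed.

Lemma adjmxD p q (A B : 'M[R[i]]_(p, q)) : adjmx (A + B) = adjmx A + adjmx B.
Proof. by apply/matrixP => i j; rewrite !mxE rmorphD. Qed.

Lemma adjmxZ p q (A : 'M[R[i]]_(p, q)) z : adjmx (z *: A) = z^* *: adjmx A.
Proof. by apply/matrixP => i j; rewrite !mxE rmorphM. Qed.

Lemma adjmx1 : adjmx (1%:M : 'M[R[i]]_N) = 1%:M.
Proof. by apply/matrixP => i j; rewrite !mxE rmorph_nat eq_sym. Qed.

Lemma adj_rot x a : adjmx (rot x a) = rot x (- a).
Proof.
rewrite /rot adjmxD adjmx1 adjmxZ adjmxM adjmxK.
congr (_ + _ *: _).
by rewrite (expiN (- a)) rmorphB rmorph1.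
Qed.

Lemma rotD x a b : dot x x = 1 -> rot x a *m rot x b = rot x (a + b).
Proof.
move=> xx; rewrite /rot mulmxDl mul1mx mulmxDr mulmx1 -scalemxAl -scalemxAr.
rewrite mulmxA outer_mulmx xx scale1r scalerA addrA -!addrA; congr (_ + _).
rewrite -!scalerDl; congr (_ *: _).
by rewrite opprD expiD; ring.
Qed.

Lemma rot0 x : rot x 0 = 1%:M.
Proof. by rewrite /rot oppr0 expi0 subrr scale0r addr0. Qed.

Lemma rot_unitary x a : dot x x = 1 -> rot x a *m adjmx (rot x a) = 1%:M.
Proof. by move=> xx; rewrite adj_rot rotD // subrr rot0. Qed.

Lemma rot_phase x z a : `|z| = 1 -> rot (z *: x) a = rot x a.
Proof.
move=> hz; rewrite /rot adjmxZ -scalemxAl -scalemxAr (scalerA z) mulrC.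
by rewrite unimodJ // scale1r.
Qed.

Lemma rot_conj A x a :
  A *m adjmx A = 1%:M -> A *m rot x a *m adjmx A = rot (A *m x) a.
Proof.
move=> AA; rewrite /rot mulmxDr mulmx1 mulmxDl AA -scalemxAr -scalemxAl.
by rewrite adjmxM !mulmxA.
Qed.

(** Only the oracle factors are counted. The parameters stay hidden, so that products and adjoints
    are handled by induction; [word_run] recovers them at the end. *)
Inductive word (W S : R -> 'M[R[i]]_N) : nat -> 'M[R[i]]_N -> Prop :=
| word1 : word W S 0 1%:M
| wordW t c A : word W S c A -> word W S c (W t *m A)
| wordS a c A : word W S c A -> word W S c.+1 (S a *m A).

Context (W : R -> 'M[R[i]]_N) (m : 'cV[R[i]]_N).
Context (W_unitary : forall t, W t *m adjmx (W t) = 1%:M).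
Context (adjW : forall t, adjmx (W t) = W (- t)).
Context (mm : dot m m = 1).

Local Notation mword := (word W (rot m)).

Lemma word_unitary c A : mword c A -> A *m adjmx A = 1%:M.
Proof.
elim=> [|t {}c {}A _ ih|a {}c {}A _ ih]; first by rewrite adjmx1 mul1mx.
  by rewrite adjmxM !mulmxA -(mulmxA _ A) ih mulmx1.
by rewrite adjmxM !mulmxA -(mulmxA _ A) ih mulmx1 rot_unitary.
Qed.

Lemma word_mul c d A B : mword c A -> mword d B -> mword (c + d) (A *m B).
Proof.
move=> hA hB; elim: hA => [|t {}c {}A _ ih|a {}c {}A _ ih].
- by rewrite mul1mx.
- by rewrite -mulmxA; exact: wordW.
- by rewrite -mulmxA addSn; exact: wordS.
Qed.

Lemma word_W t : mword 0 (W t).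
Proof. by rewrite -[W t]mulmx1; apply: wordW; exact: word1. Qed.

Lemma word_rot_m a : mword 1 (rot m a).
Proof. by rewrite -[rot m a]mulmx1; apply: wordS; exact: word1. Qed.

Lemma word_adj c A : mword c A -> mword c (adjmx A).
Proof.
elim=> [|t {}c {}A _ ih|a {}c {}A _ ih]; first by rewrite adjmx1; exact: word1.
  by rewrite adjmxM adjW -[c]addn0; apply: word_mul => //; exact: word_W.
by rewrite adjmxM adj_rot -addn1; apply: word_mul => //; exact: word_rot_m.
Qed.

(* Cost [c] counts oracle calls; states are compared up to a global phase. *)
Definition reach c u v := exists2 A, mword c A &
  exists2 z : R[i], `|z| = 1 & A *m u = z *: v.

Lemma reach_phase z u : `|z| = 1 -> reach 0 (z *: u) u.
Proof.
by move=> hz; exists 1%:M; [exact: word1|exists z; rewrite ?mul1mx].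
Qed.

Lemma reach_refl u : reach 0 u u.
Proof. by rewrite -{1}[u]scale1r; apply: reach_phase; rewrite normr1. Qed.

Lemma reach_trans c d u v w : reach c u v -> reach d v w -> reach (d + c) u w.
Proof.
move=> [A hA [y hy Au]] [B hB [z hz Bv]].
exists (B *m A); first exact: word_mul.
by exists (y * z); rewrite ?normrM ?hy ?hz ?mulr1 // -mulmxA Au -scalemxAr Bv scalerA.
Qed.

Lemma reach_sym c u v : reach c u v -> reach c v u.
Proof.
move=> [A hA [z hz Au]]; exists (adjmx A); first exact: word_adj.
exists z^*; first by rewrite norm_conjC.
have AA := mulmx1C (word_unitary hA).
rewrite -[u in RHS]mul1mx -AA -mulmxA Au -scalemxAr scalerA unimodJ //.
by rewrite scale1r.
Qed.

Lemma reachW c t u v : reach c u v -> reach c (W t *m u) v.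
Proof.
move=> h; rewrite -[c]addn0; apply: (reach_trans _ h); apply: reach_sym.
by exists (W t); [exact: word_W|exists 1; rewrite ?normr1 ?scale1r].
Qed.

(** A word [A] taking [m] to [x] up to phase conjugates the oracle into the rotation about [x],
    which does not see the phase. The calls are those of [A], of the oracle and of [adjmx A]. *)
Lemma word_rot c x a : reach c x m -> mword (2 * c + 1) (rot x a).
Proof.
move=> /reach_sym [A hA [z hz Am]].
have -> : rot x a = A *m rot m a *m adjmx A.
  by rewrite rot_conj ?(word_unitary hA) // Am rot_phase.
have -> : (2 * c + 1 = c + (1 + c))%N.
  by rewrite addnCA mul2n addnn addn1 add1n.
rewrite -mulmxA; apply: (word_mul hA); apply: word_mul (word_adj hA).
exact: word_rot_m.
Qed.

End Words.

(** * Rotations in a plane *)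

Section SineBounds.
Context {R : realType}.

Lemma sin_mvt (x : R) : 0 <= x ->
  exists2 y : R, 0 <= y <= x & sin x = cos y * x.
Proof.
move=> x0; have [|y] := @MVT_segment R sin cos 0 x x0.
  by apply: continuous_subspaceT => z; exact: continuous_sin.
by rewrite in_itv /= sin0 !subr0 => hy e; exists y.
Qed.

Lemma sin_le_id (x : R) : 0 <= x -> sin x <= x.
Proof.
by move=> x0; have [y _ ->] := sin_mvt x0; rewrite ler_piMl ?cos_le1.
Qed.

(** With [x = 2 h], [sin x = 2 cos h sin h] and [sin h = cos y * h] for some [y <= h], so
    [sin x >= 2 (cos h)^2 h]; and [(cos h)^2 >= 1 / 2] because [cos x >= 0]. *)
Lemma le_2sin (x : R) : 0 <= x <= pi / 2 -> x <= 2 * sin x.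
Proof.
move=> /andP[x0 xpi]; have pi0 := @pi_gt0 R.
have [h hx] : exists h, x = h *+ 2 by exists (x / 2); lra.
have h0 : 0 <= h by lra.
have [y /andP[y0 yh] sy] := sin_mvt h0.
have hpi : h <= pi / 4 by lra.
have cq : 1 / 2 <= cos h ^+ 2.
  have : 0 <= cos x by apply: cos_ge0_pihalf; rewrite xpi andbT; lra.
  by rewrite hx cos_mulr2n; lra.
have ch : 0 <= cos h by apply: cos_ge0_pihalf; apply/andP; split; lra.
have cy : cos h <= cos y.
  rewrite le_eqVlt; have [->//|yh'] := eqVneq y h; first by rewrite eqxx.
  have {}yh' : y < h by rewrite lt_neqAle yh' yh.
  by rewrite ltr_cos ?yh' ?orbT // in_itv /=; apply/andP; split; lra.
rewrite hx sin_mulr2n sy.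
have : cos h ^+ 2 * h <= cos h * (cos y * h).
  by rewrite expr2 -mulrA ler_wpM2l // ler_wpM2r.
have : 1 / 2 * h <= cos h ^+ 2 * h by rewrite ler_wpM2r.
lra.
Qed.

Lemma eq_normC (z w : R[i]) :
  complex.Re z ^+ 2 + complex.Im z ^+ 2 = complex.Re w ^+ 2 + complex.Im w ^+ 2 ->
  `|z| = `|w|.
Proof. by rewrite !normc_def => ->. Qed.

Lemma normCR (r : R) : `|r%:C| = `|r|%:C.
Proof. by rewrite normc_def /= expr0n addr0 sqrtr_sqr. Qed.

End SineBounds.

Section Rotation.
Context {R : realType} {N : nat}.
Context (W : R -> 'M[R[i]]_N) (m : 'cV[R[i]]_N).
Context (W_unitary : forall t, W t *m adjmx (W t) = 1%:M).
Context (adjW : forall t, adjmx (W t) = W (- t)).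
Context (mm : dot m m = 1).
Local Notation mword := (word W (rot m)).
Local Notation reach := (reach W m).

(** A rotation about [e] changes the relative phase of the two coordinates at will, so up to a
    global phase only their moduli matter. *)
Lemma reach_rot c (e f : 'cV[R[i]]_N) a b a' b' :
  dot e e = 1 -> dot e f = 0 -> (forall t, mword c (rot e t)) ->
  `|a| = `|a'| -> `|b| = `|b'| ->
  reach c (a *: e + b *: f) (a' *: e + b' *: f).
Proof.
move=> ee ef hc /esym /eq_norm_expi [p ->] /eq_norm_expi [q ->].
exists (rot e (- (p + q))) => //; exists (expi q); first exact: norm_expi.
rewrite rot_mulmx dotDr !dotZr ee ef opprK expiD.
by apply/colP => i; rewrite !mxE; ring.
Qed.

Context (e f : 'cV[R[i]]_N).
Context (ee : dot e e = 1) (ff : dot f f = 1) (ef : dot e f = 0).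

Definition pt (x : R) : 'cV[R[i]]_N := (cos x)%:C *: e + (sin x)%:C *: f.

Lemma pt0 : pt 0 = e.
Proof. by rewrite /pt cos0 sin0 scale1r scale0r addr0. Qed.

Lemma dot_frame (a b a' b' : R) :
  dot (a%:C *: e + b%:C *: f) (a'%:C *: e + b'%:C *: f) = (a * a' + b * b')%:C.
Proof.
have fe : dot f e = 0 by rewrite dotC ef conjC0.
rewrite dotDl !dotDr !dotZl !dotZr ee ff ef fe !conjCR.
by rewrite rmorphD !rmorphM /=; ring.
Qed.

(** This is [reach_rot] in the orthonormal frame made of [pt w] and its orthogonal [g]; the
    hypotheses compare moduli of coordinates in that frame. *)
Lemma reach_pt c w a b a' b' : (forall t, mword c (rot (pt w) t)) ->
  `|(cos w)%:C * a + (sin w)%:C * b| = `|(cos w)%:C * a' + (sin w)%:C * b'| ->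
  `|(cos w)%:C * b - (sin w)%:C * a| = `|(cos w)%:C * b' - (sin w)%:C * a'| ->
  reach c (a *: e + b *: f) (a' *: e + b' *: f).
Proof.
move=> hc h1 h2; pose g := (- sin w)%:C *: e + (cos w)%:C *: f.
have cs : (cos w)%:C ^+ 2 + (sin w)%:C ^+ 2 = 1 :> R[i].
  by rewrite -!rmorphXn -rmorphD /= cos2Dsin2.
have fr x y : x *: e + y *: f = ((cos w)%:C * x + (sin w)%:C * y) *: pt w +
    ((cos w)%:C * y - (sin w)%:C * x) *: g.
  have sN : (- sin w)%:C = - (sin w)%:C :> R[i] by rewrite rmorphN.
  rewrite -[LHS]scale1r -[X in X *: _]cs /pt /g sN; apply/colP => i; rewrite !mxE.
  move: (cos w)%:C (sin w)%:C (e i 0) (f i 0) => p q r s; ring.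
rewrite (fr a) (fr a'); apply: reach_rot => //.
  by rewrite dot_frame -!expr2 cos2Dsin2.
by rewrite dot_frame mulrN mulrC addNr.
Qed.

Context (c : nat) (w : R).
Context (hce : forall t, mword c (rot e t)) (hcw : forall t, mword c (rot (pt w) t)).

(** A Grover step: reflecting in [pt w] sends the angle [x] to [2 w - x], and reflecting in [e] then
    gives [x - 2 w]. *)
Lemma reach_pt_shift x : reach (2 * c) (pt x) (pt (x - w *+ 2)).
Proof.
have CD (p q r s : R) : p%:C * q%:C + r%:C * s%:C = (p * q + r * s)%:C.
  by rewrite rmorphD !rmorphM.
have CB (p q r s : R) : p%:C * q%:C - r%:C * s%:C = (p * q - r * s)%:C.
  by rewrite rmorphB !rmorphM.
have w2 : w *+ 2 - x - w = w - x by rewrite mulr2n; ring.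
rewrite mul2n -addnn; apply: (@reach_trans _ _ _ _ _ _ _ (pt (w *+ 2 - x))).
  apply: (@reach_pt c w (cos x)%:C (sin x)%:C (cos (w *+ 2 - x))%:C
    (sin (w *+ 2 - x))%:C hcw).
    rewrite !CD !normCR -!cosB; congr (_%:C).
    by rewrite -[in RHS]cosN opprB w2.
  have sB (y : R) : cos w * sin y - sin w * cos y = sin (y - w).
    by rewrite sinB; ring.
  by rewrite !CB !normCR !sB w2 -[in RHS]normrN -sinN opprB.
apply: (@reach_rot c e f (cos (w *+ 2 - x))%:C (sin (w *+ 2 - x))%:C
  (cos (x - w *+ 2))%:C (sin (x - w *+ 2))%:C ee ef hce);
  rewrite !normCR; congr (_%:C).
  by rewrite -cosN opprB.
by rewrite -normrN -sinN opprB.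
Qed.

Lemma reach_pt_iter J x : reach (2 * c * J) (pt x) (pt (x - w *+ 2 *+ J)).
Proof.
elim: J => [|J ih]; first by rewrite muln0 mulr0n subr0; exact: reach_refl.
rewrite mulnS mulrSr opprD addrA; apply: reach_trans ih _.
exact: reach_pt_shift.
Qed.

(* Tuning the relative phase [n] of [pt x] so that its component along [pt w]
   has norm [cos w], the same as that of [e], lets one rotation about [pt w]
   reach [e]; this requires [cos n = tan x / tan (2 w)]. *)
Lemma reach_pt_end x : 0 <= x <= w *+ 2 -> 0 < w -> w *+ 2 < pi / 2 ->
  reach (2 * c) (pt x) e.
Proof.
move=> /andP[x0 xw] w0 wpi; have pi0 := @pi_gt0 R.
set p := cos x; set q := sin x; set C := cos w; set S := sin w.
have p0 : 0 < p by apply: cos_gt0_pihalf; apply/andP; split; lra.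
have q0 : 0 <= q by apply: sin_ge0_pi; apply/andP; split; lra.
have C0 : 0 < C by apply: cos_gt0_pihalf; apply/andP; split; lra.
have S0 : 0 < S by apply: sin_gt0_pi; apply/andP; split; lra.
have CS : C ^+ 2 + S ^+ 2 = 1 by exact: cos2Dsin2.
have pq : p ^+ 2 + q ^+ 2 = 1 by exact: cos2Dsin2.
have c2 : 0 <= C ^+ 2 - S ^+ 2.
  have : 0 < cos (w *+ 2) by apply: cos_gt0_pihalf; apply/andP; split; lra.
  rewrite cos_mulr2n -/C; nra.
pose k := q * (C ^+ 2 - S ^+ 2) / (2 * p * (C * S)).
have den : 0 < 2 * p * (C * S) by rewrite !mulr_gt0.
have hk : k * (2 * p * (C * S)) = q * (C ^+ 2 - S ^+ 2) by rewrite divfK ?gt_eqF.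
have k0 : 0 <= k by rewrite divr_ge0 ?mulr_ge0 // ltW.
(* Up to the positive denominator, [k <= 1] says [sin (2 w - x) >= 0], which is where [x <= 2 w]
   enters. *)
have k1 : k <= 1.
  rewrite ler_pdivrMr // mul1r.
  have : 0 <= sin (w *+ 2 - x) by apply: sin_ge0_pi; apply/andP; split; lra.
  by rewrite sinB sin_mulr2n cos_mulr2n -/C -/S -/p -/q; nra.
pose n := acos k.
have cn : cos n = k by apply: acosK; rewrite in_itv /=; apply/andP; split; lra.
have sn : sin n ^+ 2 = 1 - k ^+ 2 by rewrite -cn -sin2cos2.
rewrite mul2n -addnn.
apply: (@reach_trans _ _ _ _ _ _ _ (p%:C *: e + (expi n * q%:C) *: f)).
  apply: (@reach_rot c e f p%:C q%:C p%:C (expi n * q%:C) ee ef hce) => //.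
  by rewrite normrM norm_expi mul1r.
rewrite -[X in reach _ _ X]pt0 /pt.
have sq : (sin n * q) ^+ 2 = q ^+ 2 - (k * q) ^+ 2 by rewrite exprMn sn; ring.
have kq : 2 * (k * q) * (p * C * S) = q ^+ 2 * (C ^+ 2 - S ^+ 2).
  by rewrite (_ : _ * _ = k * (2 * p * (C * S)) * q); [rewrite hk; ring|ring].
apply: (@reach_pt c w p%:C (expi n * q%:C) (cos 0)%:C (sin 0)%:C hcw);
  apply: eq_normC; rewrite cos0 sin0 /expi cn; simpc => /=.
  have -> : (C * p + S * (k * q)) ^+ 2 + (S * (sin n * q)) ^+ 2 =
     C ^+ 2 * p ^+ 2 + 2 * (k * q) * (p * C * S) +
     S ^+ 2 * ((k * q) ^+ 2 + (sin n * q) ^+ 2) by ring.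
  rewrite kq sq; transitivity (C ^+ 2 * (p ^+ 2 + q ^+ 2)); first by ring.
  by rewrite pq mulr1 expr0n addr0.
have -> : (C * (k * q) - S * p) ^+ 2 + (C * (sin n * q)) ^+ 2 =
   S ^+ 2 * p ^+ 2 - 2 * (k * q) * (p * C * S) +
   C ^+ 2 * ((k * q) ^+ 2 + (sin n * q) ^+ 2) by ring.
rewrite kq sq; transitivity (S ^+ 2 * (p ^+ 2 + q ^+ 2)); first by ring.
by rewrite pq mulr1 sqrrN expr0n addr0.
Qed.

(** One rotation makes the coordinates real, [J] Grover steps bring the angle [x = asin b] below
    [2 w], and a tuned step ends at [e]: [(3 + 2 J) c] calls. Since [x <= 2 b] and
    [w >= sin w = b d], [J <= 1 / d]. *)
Lemma reach_rotation (z1 z2 : R[i]) (a b d : R) :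
  0 < w -> w *+ 2 < pi / 2 -> `|z1| = a%:C -> `|z2| = b%:C ->
  0 <= a -> 0 <= b -> a ^+ 2 + b ^+ 2 = 1 -> 0 < d -> b * d = sin w ->
  exists2 c', reach c' (z1 *: e + z2 *: f) e & c'%:R <= (3 + 2 / d) * c%:R.
Proof.
move=> w0 wpi z1a z2b a0 b0 ab d0 bd.
have b1 : -1 <= b <= 1 by apply/andP; split; nra.
pose x := asin b.
have sx : sin x = b by apply: asinK; rewrite in_itv.
have cx : cos x = a.
  by rewrite cos_asin // -ab addrK sqrtr_sqr ger0_norm.
have pi0 := @pi_gt0 R.
have xpi : x <= pi / 2 by exact: asin_lepi2.
have x0 : 0 <= x.
  have xN : - (pi / 2) <= x by exact: asin_geNpi2.
  rewrite leNgt; apply/negP => xlt.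
  have : sin x < sin 0 by rewrite ltr_sin // in_itv /=; apply/andP; split; lra.
  by rewrite sin0 sx; lra.
have w2 : 0 < w *+ 2 by rewrite mulr2n; lra.
(* Rounding down leaves a remainder in [[0, 2 w)], as [reach_pt_end] requires. *)
pose J := Num.truncn (x / (w *+ 2)).
have /andP[Jl Ju] : J%:R <= x / (w *+ 2) < J.+1%:R.
  by apply: truncn_itv; rewrite divr_ge0 // ltW.
exists (2 * c + (2 * c * J + c))%N.
  apply: (@reach_trans _ _ _ _ _ _ _ (pt (x - w *+ 2 *+ J))).
    apply: (@reach_trans _ _ _ _ _ _ _ (pt x)); last exact: reach_pt_iter.
    apply: (@reach_rot c e f z1 z2 (cos x)%:C (sin x)%:C ee ef hce).
      by rewrite z1a cx normCR ger0_norm.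
    by rewrite z2b sx normCR ger0_norm.
  apply: reach_pt_end => //.
  move: Jl Ju; rewrite ler_pdivlMr // ltr_pdivrMr // -natr1 mulrDl mul1r mulr_natl.
  by move=> h1 h2; apply/andP; split; lra.
have sw : sin w <= w by apply: sin_le_id; exact: ltW.
have x2 : x <= 2 * b by rewrite -sx; apply: le_2sin; apply/andP; split; lra.
have sw0 : 0 < sin w by apply: sin_gt0_pi; apply/andP; split; lra.
have bpos : 0 < b by nra.
have Jd : J%:R <= 1 / d.
  apply: le_trans Jl _; rewrite ler_pdivlMr // mulrAC ler_pdivrMr // mul1r.
  by rewrite mulr2n; nra.
rewrite !natrD !natrM; have c0 : 0 <= c%:R :> R by [].
have : c%:R * J%:R <= c%:R * (1 / d) :> R by rewrite ler_wpM2l.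
by move: c0 (c%:R) (J%:R) (d^-1) => _ p q r; rewrite mul1r; lra.
Qed.

End Rotation.

(** * Removing one eigenvalue at a time *)

Section Peeling.
Context {R : realType} {N : nat}.
Context (W : R -> 'M[R[i]]_N) (m : 'cV[R[i]]_N).
Context (W_unitary : forall t, W t *m adjmx (W t) = 1%:M).
Context (adjW : forall t, adjmx (W t) = W (- t)).
Context (mm : dot m m = 1).
Local Notation mword := (word W (rot m)).
Local Notation reach := (reach W m).

(* [dot x (W t *m x)] has norm [cos w], and the component of the new vector
   orthogonal to [x] has norm [sin w / d], hence [O(1 / d)] rotations. *)
Lemma reach_step c t z x (d : R) :
  dot x x = 1 -> reach c x m ->
  1 / 2 < complex.Re (dot x (W t *m x)) ^+ 2 + complex.Im (dot x (W t *m x)) ^+ 2 ->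
  dot (W t *m x - z *: x) (W t *m x - z *: x) = (d ^+ 2)%:C ->
  0 < d -> d <= 2 ->
  exists2 c', reach c' (d^-1%:C *: (W t *m x - z *: x)) m &
    (2 * c' + 1)%:R <= 18 / d * (2 * c + 1)%:R.
Proof.
move=> xx xm g2 ww d0 d2; set y := W t *m x; set g := dot x y.
have yy : dot y y = 1.
  by rewrite /y dotM mulmxA (mulmx1C (W_unitary t)) mul1mx.
pose c0 := Num.sqrt (complex.Re g ^+ 2 + complex.Im g ^+ 2).
have c02 : c0 ^+ 2 = complex.Re g ^+ 2 + complex.Im g ^+ 2.
  by rewrite sqr_sqrtr // addr_ge0 ?sqr_ge0.
have c0ge : 0 <= c0 by exact: sqrtr_ge0.
have [p gp] : exists p, g = expi p * c0%:C.
  by apply: eq_norm_expi; rewrite normCR normc_def ger0_norm.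
(* Removing the phase of the overlap makes [dot x y'] real, so [y'] is [pt w] in the real frame of
   [x] and the normalized [h]. *)
have [y' y'E] : exists y', y' = expi (- p) *: y by eexists.
have py : y = expi p *: y'.
  by rewrite y'E scalerA mulrC expi_mulVc scale1r.
have y'y' : dot y' y' = 1.
  by rewrite y'E dotZl dotZr yy mulr1 unimodJ // norm_expi.
have xy' : dot x y' = c0%:C by rewrite y'E dotZr -/g gp mulrA expi_mulVc mul1r.
have y'x : dot y' x = c0%:C by rewrite dotC xy' conjCR.
have [h hE] : exists h, h = y' - c0%:C *: x by eexists.
have xh : dot x h = 0 by rewrite hE dotDr xy' -scaleNr dotZr xx mulr1 subrr.
have hh : dot h h = (1 - c0 ^+ 2)%:C.
  rewrite {1}hE dotDl -scaleNr dotZl xh mulr0 addr0 hE dotDr -scaleNr dotZr y'y' y'x.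
  by rewrite mulNr rmorphB rmorph1 expr2 rmorphM.
have [r r0 hr] := dot_norm_real h.
have {hr} r2 : r ^+ 2 = 1 - c0 ^+ 2 by apply/complexI; rewrite -hr hh.
have wE : W t *m x - z *: x = (expi p * c0%:C - z) *: x + expi p *: h.
  rewrite -/y py hE scalerBr scalerA scalerBl; apply/colP => i; rewrite !mxE; ring.
have dd : d^-1%:C * (d ^+ 2)%:C * d^-1%:C = 1 :> R[i].
  by rewrite -!rmorphM /= expr2 mulrA mulVf ?gt_eqF // mul1r divff ?gt_eqF.
have w1 : dot (d^-1%:C *: (W t *m x - z *: x)) (d^-1%:C *: (W t *m x - z *: x)) = 1.
  by rewrite dotZl dotZr ww conjCR mulrCA mulrC.
move: w1; rewrite wE scalerDr !scalerA.
set z1 := d^-1%:C * (_ - z).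
have c1 : 0 <= (2 * c + 1)%:R :> R by [].
have d1 : 1 <= 2 / d by rewrite ler_pdivlMr // mul1r.
(* If [r = 0] the walk fixes [x] up to phase; no plane arises, but the new vector is already [x] up
   to phase. *)
have [r_eq0|r_neq0] := eqVneq r 0.
  have -> : h = 0 by apply: dot_eq0; rewrite hh -r2 r_eq0 expr0n.
  rewrite scaler0 addr0 dotZl dotZr xx mulr1 mulJ => z1z1.
  exists c; last by move: c1; set u := _%:R; move: d1; set v := d^-1; nra.
  rewrite -[c]addn0; apply: (@reach_trans _ _ _ _ _ _ _ x) => //.
  apply: reach_phase; apply/eqP; rewrite -(@eqrXn2 _ 2) ?normr_ge0 ?ler01 //.
  by rewrite z1z1 expr1n.
have rpos : 0 < r by rewrite lt_neqAle eq_sym r_neq0.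
have [f fE] : exists f, f = r^-1%:C *: h by eexists.
have hf : h = r%:C *: f by rewrite fE scalerA -rmorphM /= divff // scale1r.
have ff : dot f f = 1.
  rewrite fE dotZl dotZr hh -r2 conjCR -!rmorphM /=.
  by rewrite (_ : r^-1 * _ = 1) //; field.
have xf : dot x f = 0 by rewrite fE dotZr xh mulr0.
have fx : dot f x = 0 by rewrite dotC xf conjC0.
rewrite hf scalerA; set z2 := _ * r%:C => w1.
have r1 : -1 <= r <= 1 by apply/andP; split; nra.
pose w := asin r.
have sw : sin w = r by apply: asinK; rewrite in_itv.
have cw : cos w = c0.
  by rewrite cos_asin // r2 subKr sqrtr_sqr ger0_norm.
have pi0 := @pi_gt0 R.
have wpi : w <= pi / 2 by exact: asin_lepi2.
have w0 : 0 < w.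
  have wN : - (pi / 2) <= w by exact: asin_geNpi2.
  rewrite ltNge; apply/negP => wle.
  have : sin 0 < sin w by rewrite sin0 sw.
  by rewrite ltr_sin ?ltNge ?wle // in_itv /=; apply/andP; split; lra.
(* The overlap hypothesis gives [cos (2 w) = 2 c0^2 - 1 > 0]. *)
have w2 : w *+ 2 < pi / 2.
  have : cos (pi / 2) < cos (w *+ 2).
    by rewrite cos_pihalf cos_mulr2n cw c02; lra.
  by rewrite ltr_cos // in_itv /=; apply/andP; split; lra.
have ptw : pt x f w = y' by rewrite /pt cw sw -hf hE addrC subrK.
have rotx s : mword (2 * c + 1) (rot x s) by exact: word_rot.
have roty s : mword (2 * c + 1) (rot (pt x f w) s).
  by rewrite ptw y'E rot_phase ?norm_expi //; apply: word_rot => //; exact: reachW.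
have [a a0 z1a] : exists2 a : R, 0 <= a & `|z1| = a%:C.
  by exists (Num.sqrt (complex.Re z1 ^+ 2 + complex.Im z1 ^+ 2));
    rewrite ?sqrtr_ge0 // normc_def.
have rd0 : 0 <= r / d by rewrite divr_ge0 // ltW.
have z2b : `|z2| = (r / d)%:C.
  rewrite !normrM norm_expi mulr1 !normCR -rmorphM /= mulrC.
  by rewrite !ger0_norm ?invr_ge0 // ltW.
have ab : a ^+ 2 + (r / d) ^+ 2 = 1.
  apply/complexI; move: w1; rewrite dotDl !dotDr !dotZl !dotZr xx ff xf fx.
  by rewrite !mulr0 !mulr1 addr0 add0r !mulJ z1a z2b -!rmorphXn -rmorphD.
have rdw : r / d * d = sin w by rewrite sw divfK // gt_eqF.
have [c' hc' c'le] :=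
  reach_rotation xx ff xf rotx roty w0 w2 z1a z2b a0 rd0 ab d0 rdw.
(* As [c' <= (3 + 2 / d) (2 c + 1)], the new count is at most [(7 + 4 / d) (2 c + 1)], and
   [7 <= 14 / d] because [d <= 2]; hence [18 = 14 + 4]. *)
exists (c + c')%N; first by apply: reach_trans hc' xm.
have e1 : (2 * c + 1)%:R = 2 * c%:R + 1 :> R by rewrite natrD natrM.
have e2 : (2 * (c + c') + 1)%:R = 2 * (c%:R + c'%:R) + 1 :> R.
  by rewrite natrD natrM natrD.
rewrite e2 e1; move: c'le d1; rewrite e1.
have : 0 <= c%:R :> R by [].
move: (c%:R) (c'%:R) (d^-1) => u v q; nra.
Qed.

Context (t : R).

Definition peel (zs : seq R[i]) (x : 'cV[R[i]]_N) :=
  foldr (fun z v => W t *m v - z *: v) x zs.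

Context (W_near1 : forall x, dot x x = 1 ->
  1 / 2 < complex.Re (dot x (W t *m x)) ^+ 2 + complex.Im (dot x (W t *m x)) ^+ 2).

(** Each factor multiplies [2 c + 1] by at most [18] over the ratio of consecutive norms of the
    unnormalized vectors. These ratios telescope to the final norm [d]. *)
Lemma reach_peel zs (d : R) : all (fun z => `|z| == 1) zs ->
  dot (peel zs m) (peel zs m) = (d ^+ 2)%:C -> 0 < d ->
  exists2 c, reach c (d^-1%:C *: peel zs m) m &
    (2 * c + 1)%:R <= 18 ^+ size zs / d.
Proof.
elim: zs d => [|z zs ih] d /=.
  move=> _; rewrite mm => /esym /(@complexI _ (d ^+ 2) 1) d2 d0.
  have -> : d = 1 by nra.
  exists 0%N; last by rewrite expr0 divr1.
  by rewrite invr1 scale1r; exact: reach_refl.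
move=> /andP[/eqP z1 hzs]; set v := peel zs m => hd d0.
have [d' d'0 hd'] := dot_norm_real v.
have {}d'0 : 0 < d'.
  rewrite lt_neqAle d'0 andbT; apply/eqP => d'e.
  have v0 : v = 0 by apply: dot_eq0; rewrite hd' -d'e expr0n.
  move: hd; rewrite v0 mulmx0 scaler0 subr0 dotE big1 => [/esym|i _].
    by move=> /(@complexI _ (d ^+ 2) 0); nra.
  by rewrite mxE mulr0.
have [c hc cle] := ih d' hzs hd' d'0.
set x := _ *: peel zs m in hc.
have xx : dot x x = 1.
  rewrite dotZl dotZr hd' conjCR -!rmorphM /=.
  by rewrite (_ : d'^-1 * _ = 1) //; field; rewrite gt_eqF.
have xE : W t *m x - z *: x = d'^-1%:C *: (W t *m v - z *: v).
  by rewrite -scalemxAr scalerBr !scalerA (mulrC z).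
have wd : dot (W t *m x - z *: x) (W t *m x - z *: x) = ((d / d') ^+ 2)%:C.
  by rewrite xE dotZl dotZr hd conjCR -!rmorphM /=; congr (_%:C); field; rewrite gt_eqF.
have dd0 : 0 < d / d' by rewrite divr_gt0.
(* By the parallelogram law, the difference of two unit vectors has squared norm at most [4]. *)
have dd2 : d / d' <= 2.
  have yy : dot (W t *m x) (W t *m x) = 1.
    by rewrite dotM mulmxA (mulmx1C (W_unitary t)) mul1mx.
  have [r r0 hr] := dot_norm_real (W t *m x + z *: x).
  have parallelogram (p q : 'cV[R[i]]_N) :
      dot (p - q) (p - q) + dot (p + q) (p + q) = 2 * (dot p p + dot q q).
    by rewrite -scaleN1r !dotDl !dotDr !dotZl !dotZr rmorphN1; ring.
  have := parallelogram (W t *m x) (z *: x).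
  rewrite wd hr yy dotZl dotZr xx mulr1 unimodJ // -rmorphD /=.
  rewrite (_ : 2 * (1 + 1) = 4%:C); last by rewrite rmorph_nat; ring.
  by move=> /complexI e; nra.
have [c' hc' c'le] := reach_step xx hc (W_near1 xx) wd dd0 dd2.
exists c'.
  rewrite (_ : d^-1%:C *: _ = (d / d')^-1%:C *: (W t *m x - z *: x)) //.
  by rewrite xE scalerA -rmorphM /=; congr (_%:C *: _); field; rewrite !gt_eqF.
apply: le_trans c'le _; rewrite exprS.
have -> : 18 * 18 ^+ size zs / d = 18 / (d / d') * (18 ^+ size zs / d').
  by field; rewrite !gt_eqF.
by rewrite ler_wpM2l // divr_ge0 // ltW.
Qed.

End Peeling.

(** * The spectrum of the Johnson graph *)

Section JohnsonSums.
Import mathcomp.boot.fintype mathcomp.boot.finset.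
Variables n k : nat.
Implicit Types (B C : jvertex n k) (T : {set 'I_n}) (b c : 'I_n).
Local Open Scope nat_scope.

(** Neighbours arise by exchanging one point of [B] for one outside. At [k = 0] the truncated [k.-1]
    would make the empty set adjacent to itself. *)
Lemma jadj_swap B (C : {set 'I_n}) : 0 < k ->
  (C \in [set val D | D : jvertex n k & jadj B D]) =
  (C \in [set p.2 |: (val B :\ p.1) | p in setX (val B) (~: val B)]).
Proof.
move=> k0; have /eqP cB := valP B; apply/imsetP/imsetP.
  move=> [D]; rewrite inE /jadj => /eqP hBD ->.
  have /eqP cD := valP D.
  have /cards1P[b hb] : #|val B :\: val D| == 1.
    by rewrite cardsD cB hBD; lia.
  have /cards1P[c hc] : #|val D :\: val B| == 1.
    by rewrite cardsD cD setIC hBD; lia.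
  have bB : b \in val B :\: val D by rewrite hb set11.
  have cD' : c \in val D :\: val B by rewrite hc set11.
  exists (b, c); first by move: bB cD'; rewrite !inE => /andP[_ ->] /andP[->].
  apply/setP => x; rewrite !inE /=.
  have /setP/(_ x) := hb; have /setP/(_ x) := hc; rewrite !inE => <-.
  have [->|] := eqVneq x b; last first.
    by case: (x \in val D); case: (x \in val B).
  by move: bB; rewrite inE => /andP[/negbTE -> ->].
move=> [[b c]]; rewrite !inE /= => /andP[bB cB'] ->.
have hC : #|c |: (val B :\ b)| == k.
  rewrite cardsU1 !inE negb_and cB' orbT.
  by apply/eqP; have := cardsD1 b (val B); rewrite bB cB => /esym.
exists (exist (fun A : {set 'I_n} => #|A| == k) _ hC) => //.
rewrite inE /jadj /=; apply/eqP.
have -> : val B :&: (c |: val B :\ b) = val B :\ b.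
  apply/setP => x; rewrite !inE; have [->|_] := eqVneq x c.
    by rewrite (negbTE cB') andbF.
  by case: (x \in val B); rewrite ?andbF ?andbT.
by apply/esym; have := cardsD1 b (val B); rewrite bB cB => /(congr1 predn).
Qed.

Lemma sum_jadj B (g : {set 'I_n} -> nat) : 0 < k ->
  \sum_(C | jadj B C) g (val C) =
  \sum_(b in val B) \sum_(c in ~: val B) g (c |: (val B :\ b)).
Proof.
move=> k0; rewrite pair_big /=.
transitivity (\sum_(C in [set val D | D : jvertex n k & jadj B D]) g C).
  rewrite big_imset /=; last by move=> ? ? _ _; exact: val_inj.
  by apply: eq_bigl => C; rewrite inE.
rewrite (eq_bigl _ _ (fun D : {set 'I_n} => jadj_swap B D k0)) big_imset /=.
  by apply: eq_bigl => -[b c]; rewrite !inE.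
(* The pair is read off from the swapped set: [b] is the point of [B] it lacks, [c] the point it
   adds. *)
move=> [b c] [b' c']; rewrite !inE /= => /andP[bB cB] /andP[bB' cB'] /setP e.
congr (_, _).
  have := e b; rewrite !inE eqxx bB /= !andbT.
  have -> : (b == c) = false by apply: contraNF cB => /eqP <-.
  have -> : (b == c') = false by apply: contraNF cB' => /eqP <-.
  by move=> /esym/negbFE/eqP.
by have := e c; rewrite !inE eqxx (negbTE cB) /= andbF orbF => /esym/eqP.
Qed.

Lemma jdegE B : 0 < k -> jdeg B = k * (n - k).
Proof.
move=> k0; have /eqP cB := valP B.
rewrite /jdeg -sum1_card (eq_bigl (fun C => jadj B C)) //.
rewrite (sum_jadj B (fun=> 1) k0) sum_nat_const sum1_card cB.
by rewrite cardsCs setCK card_ord cB.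
Qed.

Lemma sub_swap T B b c : b \in val B -> c \notin val B ->
  (T \subset c |: (val B :\ b)) = (T :\ c \subset val B) && (b \notin T).
Proof.
move=> bB cB; have bc : b != c by apply: contraNneq cB => <-.
apply/subsetP/andP => [h|[/subsetP h1 h2] x xT].
  split; last first.
    by apply/negP => /h; rewrite !inE eqxx (negbTE bc).
  apply/subsetP => x; rewrite !inE => /andP[xc /h].
  by rewrite !inE (negbTE xc) /= => /andP[].
rewrite !inE; have [//|xc] := eqVneq x c.
rewrite /= (h1 x) ?inE ?xc // andbT.
by apply: contraNneq h2 => <-.
Qed.

(** A swap contributes only if [b] is outside [T] and [T :\ c] lies in [B]. If [T] lies in [B], the
    two terms with [k - #|T| + 1] cancel; otherwise only a [T] with a single point outside [B]
    counts, and then [#|B :\: T| = k - #|T| + 1]. A term is moved to the left so that no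
    natural-number subtraction of sums occurs. *)
Lemma sum_jadj_sub T B : 0 < k -> #|T| <= k ->
  \sum_(C | jadj B C) (T \subset val C) +
    (k - #|T| + 1) * (#|T| * (T \subset val B)) =
  (k - #|T|) * (n - k) * (T \subset val B) +
  (k - #|T| + 1) * \sum_(x in T) (T :\ x \subset val B).
Proof.
move=> k0 Tk; have /eqP cB := valP B.
have cBC : #|~: val B| = n - k by rewrite cardsCs setCK card_ord cB.
rewrite (sum_jadj B (fun D : {set _} => T \subset D : nat) k0).
have -> : \sum_(b in val B) \sum_(c in ~: val B) (T \subset c |: (val B :\ b)) =
    #|val B :\: T| * \sum_(c in ~: val B) (T :\ c \subset val B).
  rewrite -sum1_card big_distrl /= (big_setID T) /= [X in X + _]big1 ?add0n.
    apply: eq_bigr => b; rewrite inE => /andP[bT bB]; rewrite mul1n.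
    by apply: eq_bigr => c; rewrite inE => cB'; rewrite sub_swap // bT andbT.
  move=> b; rewrite inE => /andP[bB bT]; apply: big1 => c; rewrite inE => cB'.
  by rewrite sub_swap // bT andbF.
have [TB|TB] := boolP (T \subset val B).
  have -> : #|val B :\: T| = k - #|T|.
    by rewrite cardsD cB (setIidPr TB).
  have sub c : T :\ c \subset val B by apply: subset_trans TB; exact: subsetDl.
  under eq_bigr do rewrite sub; under [in RHS]eq_bigr do rewrite sub.
  by rewrite !sum1_card cBC !muln1.
rewrite !muln0 add0n addn0.
have zero x : (x \in T) = (x \in val B) -> (T :\ x \subset val B) = false.
  move=> h; apply: contraNF TB => /subsetP h1; apply/subsetP => y yT.
  by have [e|yx] := eqVneq y x; [rewrite e -h -e|apply: h1; rewrite !inE yx].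
have -> : \sum_(c in ~: val B) (T :\ c \subset val B) =
    \sum_(x in T) (T :\ x \subset val B).
  rewrite big_mkcond [RHS]big_mkcond; apply: eq_bigr => x _; rewrite inE.
  case xB: (x \in val B); case xT: (x \in T) => //=; rewrite zero ?xB //.
have [->|] := eqVneq (\sum_(x in T) (T :\ x \subset val B)) 0.
  by rewrite !muln0.
rewrite sum_nat_eq0 negb_forall => /existsP[x]; rewrite negb_imply => /andP[xT].
rewrite eqb0 negbK => hx; congr (_ * _).
have xB : x \notin val B.
  by apply/negP => xB; move: hx; rewrite zero // xT xB.
rewrite cardsD cB; have -> : val B :&: T = T :\ x.
  apply/setP => y; rewrite !inE; have [->|yx] /= := eqVneq y x.
    by rewrite (negbTE xB).
  case yT: (y \in T); rewrite ?andbF ?andbT //.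
  by apply: (subsetP hx); rewrite !inE yx.
by have := cardsD1 x T; rewrite xT; move: Tk; lia.
Qed.

End JohnsonSums.

(** * The Laplacian on indicators of containment *)

Section JohnsonSpectrum.
Import mathcomp.boot.fintype mathcomp.boot.finset.
Context {R : realType}.
Variables n k : nat.
Context (k0 : (0 < k)%N) (kn : (k <= n)%N).
Implicit Types (T : {set 'I_n}).
Local Notation N := (jN n k).
Local Notation L := (@jlaplacian R n k).

Definition upset T : 'cV[R[i]]_N :=
  \col_i (T \subset val (enum_val i : jvertex n k))%:R.

Definition jeig (l : nat) : nat := (l * (n.+1 - l))%N.

Lemma sum_jvertex (F : jvertex n k -> R[i]) :
  \sum_(j < N) F (enum_val j) = \sum_C F C.
Proof. rewrite [RHS](reindex (fun j : 'I_N => enum_val j)) //.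
by apply: onW_bij; exact: enum_val_bij. Qed.

Lemma mul_laplacian (u : 'cV[R[i]]_N) i :
  (L *m u) i 0 = (jdeg (enum_val i))%:R * u i 0 -
    \sum_j (jadj (enum_val i) (enum_val j))%:R * u j 0.
Proof.
rewrite mxE; under eq_bigr do rewrite mxE mulrBl.
rewrite sumrB; congr (_ - _); rewrite (bigD1 i) //= eqxx big1 ?addr0 //.
by move=> j; rewrite eq_sym => /negbTE ->; rewrite mul0r.
Qed.

(** With [j = #|T|], the coefficient of [upset T] is the degree minus the counts of [sum_jadj_sub]:
    [k (n - k) - (k - j) (n - k) + (k - j + 1) j = j (n + 1 - j)]. *)
Lemma laplacian_upset T : (#|T| <= k)%N ->
  L *m upset T = (jeig #|T|)%:R *: upset T -
    (k - #|T| + 1)%:R *: \sum_(x in T) upset (T :\ x).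
Proof.
move=> Tk; apply/colP => i; rewrite mul_laplacian !mxE summxE.
set B := enum_val i; rewrite jdegE //.
under eq_bigr do rewrite mxE; under [in RHS]eq_bigr do rewrite mxE.
rewrite (sum_jvertex (fun C => (jadj B C)%:R * (T \subset val C)%:R)).
have -> : \sum_C (jadj B C)%:R * (T \subset val C)%:R =
    (\sum_(C | jadj B C) (T \subset val C))%N%:R :> R[i].
  rewrite natr_sum [RHS]big_mkcond; apply: eq_bigr => C _.
  by case: ifP => _; rewrite ?mul1r ?mul0r.
rewrite -natr_sum -!natrM; apply/eqP; rewrite subr_eq addrAC eq_sym subr_eq eq_sym.
rewrite -!natrD eqr_nat; apply/eqP.
have := sum_jadj_sub B k0 Tk; rewrite -/B /jeig.
move: (\sum_(C | _) _)%N (\sum_(x in T) _)%N => a g.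
case: (T \subset val B); rewrite ?muln0 ?muln1 ?addn0 ?add0n; last by move->.
move: kn Tk; move: #|T| => j kn' jk e.
(* Writing [k = j + p] and [n = k + q] turns the truncated subtractions into additions. *)
have [p hp] : exists p, k = (j + p)%N by exists (k - j)%N; lia.
have [q hq] : exists q, n = (k + q)%N by exists (n - k)%N; lia.
have e1 : (k - j = p)%N by lia.
have e2 : (n - k = q)%N by lia.
have e3 : (n.+1 - j = p + q + 1)%N by lia.
move: e; rewrite e1 e2 e3. rewrite ?hp; nia.
Qed.

Inductive upspan (j : nat) : 'cV[R[i]]_N -> Prop :=
| upspan0 : upspan j 0
| upspanD a T v : #|T| = j -> upspan j v -> upspan j (a *: upset T + v).

Lemma upspan_add j u v : upspan j u -> upspan j v -> upspan j (u + v).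
Proof.
move=> hu hv; elim: hu => [|a T {}u hT _ ih]; first by rewrite add0r.
by rewrite -addrA; exact: upspanD.
Qed.

Lemma upspan_scale j a u : upspan j u -> upspan j (a *: u).
Proof.
elim=> [|b T {}u hT _ ih]; first by rewrite scaler0; exact: upspan0.
by rewrite scalerDr scalerA; exact: upspanD.
Qed.

Lemma upspan_upset T : upspan #|T| (upset T).
Proof.
by rewrite -[upset T]scale1r -[X in upspan _ X]addr0; apply: upspanD;
  last exact: upspan0.
Qed.

Lemma laplacian_upspan j v : (j < k)%N -> upspan j.+1 v ->
  upspan j (L *m v - (jeig j.+1)%:R *: v).
Proof.
move=> jk; elim=> [|a T u hT _ ih].
  by rewrite mulmx0 scaler0 subr0; exact: upspan0.
rewrite mulmxDr scalerDr opprD addrACA; apply: upspan_add ih.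
rewrite -scalemxAr scalerA mulrC -scalerA -scalerBr; apply: upspan_scale.
rewrite laplacian_upset ?hT // addrAC subrr sub0r -scaleNr.
apply: upspan_scale; elim/big_ind: _ => [||x xT].
- exact: upspan0.
- exact: upspan_add.
- have e : #|T :\ x| = j by have := cardsD1 x T; rewrite xT hT => -[].
  by rewrite -e; exact: upspan_upset.
Qed.

Lemma upset0E : upset set0 = const_mx 1.
Proof. by apply/colP => i; rewrite !mxE sub0set. Qed.

Lemma upspan_0 v : upspan 0 v -> exists a, v = a *: const_mx 1.
Proof.
elim=> [|b T u hT _ [a ->]]; first by exists 0; rewrite scale0r.
by exists (b + a); rewrite (cards0_eq hT) upset0E scalerDl.
Qed.

Lemma laplacian_const : L *m const_mx 1 = 0 :> 'cV_N.
Proof.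
rewrite -upset0E laplacian_upset ?cards0 // /jeig mul0n scale0r sub0r.
by rewrite big_set0 scaler0 oppr0.
Qed.

(** Vertices have equal size, so only [m] itself contains [m]. This starts the descent from degree
    [k]. *)
Lemma ket_upset (m : jvertex n k) : ket (enum_rank m) = upset (val m).
Proof.
apply/colP => i; rewrite !mxE eqxx andbT.
congr ((_ : bool)%:R); apply/eqP/idP => [->|].
  by rewrite enum_rankK.
have /eqP hm := valP m; have /eqP hi := valP (enum_val i) => s.
rewrite -(enum_valK i); congr enum_rank; apply: val_inj; apply/esym/eqP.
by rewrite eqEcard s hm hi leqnn.
Qed.

Definition lpeel (ls : seq nat) (v : 'cV[R[i]]_N) :=
  foldr (fun l u => L *m u - (jeig l)%:R *: u) v ls.

(** The [foldr] applies the factor for [i] first and that for [1] last, so each one meets the degree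
    it lowers. *)
Lemma lpeel_upspan i v : (i <= k)%N -> upspan i v ->
  upspan 0 (lpeel (iota 1 i) v).
Proof.
elim: i v => [|i ih] v ik hv //.
rewrite -[i.+1]addn1 iotaD /lpeel foldr_cat /= add1n.
by apply: ih; [exact: ltnW|exact: laplacian_upspan].
Qed.

Lemma lpeel_ket (m : jvertex n k) : exists a,
  lpeel (iota 1 k) (ket (enum_rank m)) = a *: const_mx 1.
Proof.
apply: upspan_0; apply: lpeel_upspan => //; rewrite ket_upset.
by have /eqP {1}<- := valP m; exact: upspan_upset.
Qed.

Lemma laplacian_sym i j : L i j = L j i.
Proof.
rewrite !mxE eq_sym /jadj setIC; congr (_ - _).
by case: eqP => // ->.
Qed.

Lemma adj_laplacian : adjmx L = L.
Proof.
apply/matrixP => i j; rewrite mxE laplacian_sym mxE rmorphB rmorph_nat.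
by case: ifP; rewrite ?rmorph_nat ?rmorph0.
Qed.

Lemma spectral_coord (A Q : 'M[R[i]]_N) (D : 'rV_N) (v : 'cV_N) j :
  Q *m adjmx Q = 1%:M -> A = adjmx Q *m diag_mx D *m Q ->
  (Q *m (A *m v)) j 0 = D 0 j * (Q *m v) j 0.
Proof.
move=> QQ ->; rewrite !mulmxA QQ mul1mx -mulmxA mul_diag_mx mxE.
by [].
Qed.

Lemma foldr_coord (I : Type) (A Q : 'M[R[i]]_N) (D : 'rV_N) (F : I -> R[i])
    (s : seq I) (v : 'cV_N) j :
  Q *m adjmx Q = 1%:M -> A = adjmx Q *m diag_mx D *m Q ->
  (Q *m foldr (fun l u => A *m u - F l *: u) v s) j 0 =
  (\prod_(l <- s) (D 0 j - F l)) * (Q *m v) j 0.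
Proof.
move=> QQ AE; elim: s => [|l s ih] /=; first by rewrite big_nil mul1r.
rewrite mulmxBr -scalemxAr [LHS]mxE (spectral_coord _ _ QQ AE) ih.
rewrite big_cons [X in _ + X]mxE [X in _ - X]mxE ih; ring.
Qed.

(** [L] is Hermitian, hence unitarily diagonalizable. Applying [L] and all the factors [L - jeig l]
    to any [ket i] gives [0]; in eigencoordinate [j] this is a polynomial in the eigenvalue times
    [Q j i], and [i] is chosen with [Q j i] nonzero. *)
Lemma laplacian_spectral : exists (Q : 'M[R[i]]_N) (d : 'I_N -> nat),
  [/\ Q *m adjmx Q = 1%:M,
      L = adjmx Q *m diag_mx (\row_j (jeig (d j))%:R) *m Q &
      forall j, (d j <= k)%N].
Proof.
have nL : L \is normalmx.
  by apply/normalmxP; rewrite -adjmxE adj_laplacian.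
have /orthomx_spectralP := nL.
set Q := spectralmx L; set D := spectral_diag L.
have uQ : Q \is unitarymx by exact: spectral_unitarymx.
rewrite invmx_unitary // -adjmxE => LE.
have QQ : Q *m adjmx Q = 1%:M by rewrite adjmxE; exact/unitarymxP.
have Dj j : exists l : nat, (l <= k)%N && (D 0 j == (jeig l)%:R).
  have [i Qji] : exists i, Q j i != 0.
    apply: contrapT => h.
    have /matrixP/(_ j j) := QQ; rewrite !mxE eqxx big1 => [/esym/eqP|i _].
      by rewrite oner_eq0.
    have [->|q] := eqVneq (Q j i) 0; first by rewrite mul0r.
    by case: h; exists i.
  have [a ha] := lpeel_ket (enum_val i).
  have : (Q *m (L *m lpeel (iota 1 k) (ket i))) j 0 = 0.
    by move: ha; rewrite enum_valK => ->; rewrite -scalemxAr laplacian_const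
       scaler0 mulmx0 mxE.
  rewrite (spectral_coord _ _ QQ LE) (foldr_coord _ _ _ _ QQ LE).
  rewrite -colE mxE => /eqP; rewrite !mulf_eq0 (negbTE Qji) orbF.
  move=> /orP[D0|]; first by exists 0%N; rewrite /jeig mul0n.
  rewrite prodf_seq_eq0 => /hasP[l]; rewrite mem_iota /= subr_eq0 => hl Dl.
  by exists l; rewrite Dl andbT; lia.
have [d hd] := fin_all_exists Dj.
exists Q, d; split; [exact: QQ| |by move=> j; have /andP[] := hd j].
rewrite {1}LE; congr (_ *m diag_mx _ *m _); apply/rowP => j; rewrite mxE.
by have /andP[_ /eqP] := hd j.
Qed.

End JohnsonSpectrum.

(** * The walk and search operators *)

Section Operators.
Context {R : realType}.

Lemma adj_ket N (i : 'I_N) : adjmx (ket i : 'cV[R[i]]_N) = (ket i)^T.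
Proof. by apply/matrixP => p q; rewrite !mxE rmorph_nat. Qed.

Lemma dot_ket N (i : 'I_N) (u : 'cV[R[i]]_N) : dot u (ket i) = (u i 0)^*.
Proof. by rewrite /dot -colE mxE mxE. Qed.

Lemma dot_ket1 N (i : 'I_N) : dot (ket i : 'cV[R[i]]_N) (ket i) = 1.
Proof. by rewrite dot_ket mxE !eqxx rmorph1. Qed.

(** The exponent is already diagonal, so [expmx_diag] applies with the identity as [Q]. *)
Lemma search_opE N (i : 'I_N) (a : R) : search_op i a = rot (ket i) a.
Proof.
pose d (j : 'I_N) : R := if j == i then - a else 0.
have := @expmx_diag R N 1%:M d; rewrite adjmx1 !mul1mx !mulmx1 => /(_ erefl).
rewrite /search_op /rot adj_ket.
have kk : ket i *m (ket i)^T = delta_mx i i :> 'M[R[i]]_N.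
  by rewrite trmx_delta mul_delta_mx.
rewrite kk => e; transitivity (expmx (diag_mx (\row_j ('i * (d j)%:C)))).
  congr expmx; apply/matrixP => p q; rewrite !mxE /d.
  have [->|pq] := eqVneq p q; last first.
    rewrite mulr0n; case: eqVneq => [pi|_] /=; last by rewrite mulr0.
    by rewrite -pi eq_sym (negbTE pq) mulr0.
  rewrite mulr1n andbb; case: ifP => _; last by rewrite !mulr0.
  by rewrite mulr1 rmorphN mulrN.
rewrite e; apply/matrixP => p q; rewrite !mxE /d.
have [->|pq] := eqVneq p q; last first.
  rewrite !mulr0n add0r; case: eqVneq => [pi|_] /=; last by rewrite mulr0.
  by rewrite -pi eq_sym (negbTE pq) mulr0.
rewrite !mulr1n andbb; case: ifP => _; last by rewrite expi0 mulr0 addr0.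
by rewrite mulr1 addrC subrK.
Qed.

Variables n k : nat.
Context (k0 : (0 < k)%N) (kn : (k <= n)%N).
Local Notation N := (jN n k).
Local Notation L := (@jlaplacian R n k).
Context (Q : 'M[R[i]]_N) (d : 'I_N -> nat).
Context (QQ : Q *m adjmx Q = 1%:M).
Context (LE : L = adjmx Q *m diag_mx (\row_j (jeig n (d j))%:R) *m Q).
Context (dk : forall j, (d j <= k)%N).

Local Notation phase t j := (expi (- (t * (jeig n (d j))%:R)) : R[i]).

Lemma walk_opE t :
  walk_op n k t = adjmx Q *m diag_mx (\row_j phase t j) *m Q.
Proof.
rewrite -(expmx_diag (fun j => - (t * (jeig n (d j))%:R)) QQ) /walk_op.
congr (expmx _); rewrite [X in _ *: X]LE scalemxAl scalemxAr.
congr (_ *m _ *m _).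
apply/matrixP => p q; rewrite !mxE.
case: (p == q); rewrite ?mulr1n ?mulr0n ?mulr0 //.
rewrite -(rmorph_nat (real_complex R)) mulNr -mulrA -rmorphM -mulrN -rmorphN.
by [].
Qed.

Lemma walk_opD s t : walk_op n k s *m walk_op n k t = walk_op n k (s + t) :> 'M[R[i]]_N.
Proof.
rewrite !walk_opE !mulmxA -[_ *m Q *m adjmx Q]mulmxA QQ mulmx1.
rewrite -[_ *m diag_mx _ *m diag_mx _]mulmxA mulmx_diag; congr (_ *m diag_mx _ *m _).
by apply/rowP => j; rewrite !mxE -expiD mulrDl opprD.
Qed.

Lemma walk_op0 : walk_op n k 0 = 1%:M :> 'M[R[i]]_N.
Proof.
rewrite walk_opE (_ : diag_mx _ = 1%:M) ?mulmx1; first exact: mulmx1C.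
by apply/matrixP => p q; rewrite !mxE mul0r oppr0 expi0.
Qed.

Lemma adj_walk_op t : adjmx (walk_op n k t) = walk_op n k (- t) :> 'M[R[i]]_N.
Proof.
rewrite !walk_opE !adjmxM adjmxK mulmxA; congr (_ *m _ *m _).
apply/matrixP => p q; rewrite !mxE eq_sym rmorphMn /=.
by case: eqVneq => [->|_]; rewrite ?mulr0n // -expiN mulNr.
Qed.

Lemma walk_op_unitary t : walk_op n k t *m adjmx (walk_op n k t) = 1%:M :> 'M[R[i]]_N.
Proof. by rewrite adj_walk_op walk_opD subrr walk_op0. Qed.

(** The overlap is an average of the eigenphases with weights the squared moduli of [Q *m x], so its
    real part is at least [3 / 4], and [9 / 16 > 1 / 2]. *)
Lemma walk_op_near1 t (x : 'cV[R[i]]_N) :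
  (forall j, 3 / 4 <= cos (t * (jeig n (d j))%:R)) -> dot x x = 1 ->
  1 / 2 < complex.Re (dot x (walk_op n k t *m x)) ^+ 2 +
          complex.Im (dot x (walk_op n k t *m x)) ^+ 2.
Proof.
move=> ht xx.
have [r [r0 rE]] : exists r : 'I_N -> R, (forall j, 0 <= r j) /\
    forall j, ((Q *m x) j 0)^* * (Q *m x) j 0 = (r j)%:C.
  exists (fun j => complex.Re ((Q *m x) j 0) ^+ 2 + complex.Im ((Q *m x) j 0) ^+ 2).
  split=> j; first by rewrite addr_ge0 ?sqr_ge0.
  by rewrite mulJ add_Re2_Im2.
have r1 : \sum_j r j = 1.
  apply/complexI; rewrite rmorph_sum /=; under eq_bigr do rewrite -rE.
  by rewrite -dotE dotM mulmxA (mulmx1C QQ) mul1mx.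
have -> : dot x (walk_op n k t *m x) = \sum_j (r j)%:C * phase t j.
  rewrite walk_opE -!mulmxA dotM adjmxK dotE; apply: eq_bigr => j _.
  by rewrite -rE mul_diag_mx !mxE mulrCA mulrC.
have Re_sum : complex.Re (\sum_j (r j)%:C * phase t j) =
    \sum_j r j * cos (t * (jeig n (d j))%:R).
  elim/big_rec2: _ => // j y z _ <-; rewrite /expi cosN.
  by case: z => u v; simpc.
have Re_ge : 3 / 4 <= complex.Re (\sum_j (r j)%:C * phase t j).
  have -> : 3 / 4 = \sum_j r j * (3 / 4) by rewrite -mulr_suml r1 mul1r.
  by rewrite Re_sum; apply: ler_sum => j _; rewrite ler_wpM2l.
have := sqr_ge0 (complex.Im (\sum_j (r j)%:C * phase t j)); nra.
Qed.

Definition peel_phases t : seq R[i] :=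
  [seq expi (- (t * (jeig n l)%:R)) | l <- iota 1 k].

Lemma jeig_gt0 l : l \in iota 1 k -> (0 < jeig n l)%N.
Proof. by rewrite mem_iota muln_gt0; lia. Qed.

(** In the eigenbasis, both the walk factors and the Laplacian factors kill every coordinate with
    [d j > 0] and act as the scalars [A] and [B] on the rest. The known multiple of the constant
    vector therefore transfers, and pairing with that vector fixes it. *)
Lemma peel_ket t (m : jvertex n k) :
  peel (walk_op n k) t (peel_phases t) (ket (enum_rank m)) =
  ((\prod_(z <- peel_phases t) (1 - z)) / N%:R) *: const_mx 1.
Proof.
set A := \prod_(z <- _) _; pose B : R[i] := \prod_(l <- iota 1 k) (- (jeig n l)%:R).
have B0 : B != 0.
  rewrite prodf_seq_neq0; apply/allP => l hl /=.
  by rewrite oppr_eq0 pnatr_eq0 -lt0n jeig_gt0.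
have [a la] := @lpeel_ket R n k k0 kn m.
have pl : peel (walk_op n k) t (peel_phases t) (ket (enum_rank m)) =
    (A / B) *: lpeel (iota 1 k) (ket (enum_rank m)).
  rewrite -[LHS]mul1mx -[RHS]mul1mx -(mulmx1C QQ) -!mulmxA; congr (_ *m _).
  rewrite -scalemxAr; apply/colP => j; rewrite [RHS]mxE.
  rewrite (foldr_coord id _ _ _ QQ (walk_opE t)) (foldr_coord _ _ _ _ QQ LE) !mxE.
  rewrite mulrA; congr (_ * _).
  have [dj0|dj0] := posnP (d j).
    have -> : \prod_(l <- iota 1 k) ((jeig n (d j))%:R - (jeig n l)%:R) = B :> R[i].
      by apply: eq_bigr => l _; rewrite dj0 /jeig mul0n sub0r.
    rewrite divfK //; apply: eq_bigr => z _.
    by rewrite dj0 /jeig mul0n mulr0 oppr0 expi0.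
  have dj : d j \in iota 1 k by rewrite mem_iota dj0 add1n ltnS dk.
  transitivity (0 : R[i]).
    apply/eqP; rewrite prodf_seq_eq0; apply/hasP; exists (phase t j).
      by apply/mapP; exists (d j).
    by rewrite /= subrr.
  apply/esym/eqP; rewrite mulf_eq0 prodf_seq_eq0; apply/orP; right.
  by apply/hasP; exists (d j); rewrite //= subrr.
have cN : dot (const_mx 1) (const_mx 1 : 'cV[R[i]]_N) = N%:R.
  rewrite dotE -[N in RHS]card_ord -sumr_const; apply: eq_bigr => j _.
  by rewrite !mxE rmorph1 mul1r.
(* [L] is Hermitian and kills constants, so only the scalar part of each factor survives the
   pairing. *)
have step ls (u : 'cV[R[i]]_N) : dot (const_mx 1) (lpeel ls u) =
    (\prod_(l <- ls) (- (jeig n l)%:R)) * dot (const_mx 1) u.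
  elim: ls => [|l ls ih] /=; first by rewrite big_nil mul1r.
  rewrite -scaleNr dotDr dotM adj_laplacian laplacian_const // dotZr ih big_cons.
  by rewrite mulrA [X in X + _](_ : _ = 0) ?add0r // -(scale0r 0) dotZl conjC0 mul0r.
have aN : a * N%:R = B.
  have := step (iota 1 k) (ket (enum_rank m)); rewrite la dotZr cN => ->.
  by rewrite dot_ket mxE rmorph1 mulr1.
have N0 : N%:R != 0 :> R[i] by apply: contraNneq B0 => N0; rewrite -aN N0 mulr0.
rewrite pl la scalerA; congr (_ *: _).
by rewrite -aN; field; rewrite N0 /=; apply: contraNneq B0 => a0; rewrite -aN a0 mul0r.
Qed.

End Operators.

(** * Independence of the marked vertex *)

Section Runs.
Context {R : realType} {N : nat}.
Context (W S : R -> 'M[R[i]]_N).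
Context (WD : forall s t, W s *m W t = W (s + t)) (W0 : W 0 = 1%:M).

Definition run (t0 : R) (ps : seq (R * R)) (v : 'cV[R[i]]_N) :=
  foldl (fun psi p => W p.2 *m (S p.1 *m psi)) (W t0 *m v) ps.

(** Adjacent walks merge by [WD], and a walk of time [0] is inserted after each oracle call, giving
    the strict alternation of [search_run]. *)
Lemma word_run c A : word W S c A ->
  exists t0 ps, size ps = c /\ forall v, A *m v = run t0 ps v.
Proof.
elim=> [|t {}c {}A _ [t0 [ps [hc hA]]]|a {}c {}A _ [t0 [ps [hc hA]]]].
- by exists 0, [::]; split => // v; rewrite /run /= W0.
- case/lastP: ps hc hA => [|ps [a s]] hc hA.
    by exists (t + t0), [::]; split => // v; rewrite -mulmxA hA /run /= mulmxA WD.
  exists t0, (rcons ps (a, t + s)); split; first by rewrite -hc !size_rcons.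
  by move=> v; rewrite -mulmxA hA /run !foldl_rcons /= -WD !mulmxA.
- exists t0, (rcons ps (a, 0)); split; first by rewrite size_rcons hc.
  by move=> v; rewrite -mulmxA hA /run foldl_rcons /= W0 mul1mx.
Qed.

End Runs.

(** * Permutations of the points acting on the search *)

Lemma perm_mapping (T : finType) (A B : {set T}) : #|A| = #|B| ->
  exists s : {perm T}, forall x, (s x \in B) = (x \in A).
Proof.
move=> AB.
(* The permutation matches positions in the two lists, each a set followed by its complement. *)
pose l (C : {set T}) := enum C ++ enum (~: C).
have lu C : uniq (l C).
  rewrite cat_uniq !enum_uniq andbT; apply/hasPn => x.
  by rewrite !mem_enum inE.
have lx C x : x \in l C by rewrite mem_cat !mem_enum inE orbN.
have sl C : size (l C) = #|T|.
  by rewrite size_cat -!cardE cardsC.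
pose f x := nth x (l B) (index x (l A)).
have fi : injective f.
  move=> x y; rewrite /f (set_nth_default y) ?sl -?(sl A) ?index_mem // => /eqP.
  rewrite nth_uniq ?sl -?(sl A) ?index_mem // => /eqP /(congr1 (nth x (l A))).
  by rewrite !nth_index.
exists (perm fi) => x; rewrite permE /f /l nth_cat !index_cat mem_enum -!cardE.
case: (boolP (x \in A)) => xA.
  have h : (index x (enum A) < #|B|)%N by rewrite -AB cardE index_mem mem_enum.
  by rewrite h -mem_enum mem_nth // -cardE.
rewrite -AB ltnNge leq_addr /= addKn.
apply/negbTE; have := @mem_nth _ x (enum (~: B)) (index x (enum (~: A))).
rewrite mem_enum inE; apply.
have -> : size (enum (~: B)) = size (enum (~: A)).
  by have := cardsC B; have := cardsC A; rewrite -AB -!cardE; lia.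
by rewrite index_mem mem_enum inE.
Qed.

Section Symmetry.
Import mathcomp.boot.fintype mathcomp.boot.finset.
Context {R : realType} (n k : nat) (s : {perm 'I_n}).
Local Notation N := (jN n k).

Lemma card_perm_vertex (C : jvertex n k) : #|[set s x | x in val C]%SET| == k.
Proof. by rewrite card_imset; [exact: (valP C)|exact: perm_inj]. Qed.

Definition permv (C : jvertex n k) : jvertex n k :=
  exist (fun A : {set 'I_n} => #|A| == k) _ (card_perm_vertex C).

Definition permi (i : 'I_N) : 'I_N := enum_rank (permv (enum_val i)).

Lemma permv_inj : injective permv.
Proof.
move=> C D /(congr1 val) /= e; apply: val_inj.
exact: (imset_inj (@perm_inj _ s)) e.
Qed.

Lemma permi_inj : injective permi.
Proof. by move=> i j /enum_rank_inj /permv_inj /enum_val_inj. Qed.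

Lemma jadj_perm C D : jadj (permv C) (permv D) = jadj C D.
Proof.
rewrite /jadj /= -imsetI; last by move=> x y _ _; exact: perm_inj.
by rewrite card_imset //; exact: perm_inj.
Qed.

Lemma jdeg_perm C : jdeg (permv C) = jdeg C.
Proof.
rewrite /jdeg -(card_image permv_inj (fun D => jadj C D)).
apply: eq_card => D; rewrite !inE.
have [g gK Kg] := injF_bij permv_inj.
by rewrite -(Kg D) jadj_perm (mem_image permv_inj).
Qed.

(** Conjugation by the permutation matrix of [permi], kept entrywise so that products reduce to
    reindexing sums. *)
Definition mxperm (A B : 'M[R[i]]_N) := forall i j, B (permi i) (permi j) = A i j.

Lemma sum_permi (F : 'I_N -> R[i]) : \sum_j F j = \sum_j F (permi j).
Proof. by rewrite (reindex permi) //; exact/onW_bij/injF_bij/permi_inj. Qed.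

Lemma mxpermM A A' B B' : mxperm A B -> mxperm A' B' -> mxperm (A *m A') (B *m B').
Proof.
move=> h h' i j; rewrite !mxE sum_permi.
by apply: eq_bigr => p _; rewrite h h'.
Qed.

Lemma mxperm_expmx A B : mxperm A B -> mxperm (expmx A) (expmx B).
Proof.
move=> h i j; rewrite [LHS]mxE [RHS]mxE.
have e M : expmx_psum B M (permi i) (permi j) = expmx_psum A M i j.
  rewrite /expmx_psum [LHS]summxE [RHS]summxE; apply: eq_bigr => l _.
  rewrite [LHS]mxE [RHS]mxE; congr (_ * _); elim: (val l) i j => [|p ih] i' j'.
    by rewrite !expr0 !mxE (inj_eq permi_inj).
  by rewrite !exprS; apply: mxpermM.
have eRe : (fun M => complex.Re (expmx_psum B M (permi i) (permi j))) =
    (fun M => complex.Re (expmx_psum A M i j)).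
  exact: (funext (fun M => congr1 (@complex.Re R) (e M))).
have eIm : (fun M => complex.Im (expmx_psum B M (permi i) (permi j))) =
    (fun M => complex.Im (expmx_psum A M i j)).
  exact: (funext (fun M => congr1 (@complex.Im R) (e M))).
rewrite eRe eIm; reflexivity.
Qed.

Lemma mxpermZ a A B : mxperm A B -> mxperm (a *: A) (a *: B).
Proof. by move=> h i j; rewrite !mxE h. Qed.

Lemma walk_op_perm t : mxperm (walk_op n k t) (walk_op n k t).
Proof.
apply/mxperm_expmx/mxpermZ => i j; rewrite !mxE (inj_eq permi_inj).
by rewrite /permi !enum_rankK jadj_perm jdeg_perm.
Qed.

Lemma search_op_perm p a : mxperm (search_op p a) (search_op (permi p) a).
Proof.
apply/mxperm_expmx/mxpermZ => i j.
by rewrite !trmx_delta !mul_delta_mx !mxE !(inj_eq permi_inj).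
Qed.

(** The walk and the uniform state are invariant under the permutation, and the oracle of [C]
    becomes that of [permv C]. *)
Lemma search_run_perm (t0 : R) ps C i :
  search_run t0 ps (permv C) (permi i) 0 = search_run t0 ps C i 0.
Proof.
have mulv A B (u v : 'cV[R[i]]_N) : mxperm A B ->
    (forall i, v (permi i) 0 = u i 0) -> forall i, (B *m v) (permi i) 0 = (A *m u) i 0.
  move=> h hv i'; rewrite !mxE sum_permi; apply: eq_bigr => j _.
  by rewrite h hv.
have hC : enum_rank (permv C) = permi (enum_rank C) by rewrite /permi enum_rankK.
have main (u v : 'cV[R[i]]_N) : (forall i, v (permi i) 0 = u i 0) -> forall i,
    (foldl (fun psi q => walk_op n k q.2 *m
       (search_op (enum_rank (permv C)) q.1 *m psi)) v ps) (permi i) 0 =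
    (foldl (fun psi q => walk_op n k q.2 *m
       (search_op (enum_rank C) q.1 *m psi)) u ps) i 0.
  elim: ps u v => [//|p ps ih] u v huv /=; apply: ih.
  apply: (mulv); first exact: walk_op_perm.
  by apply: (mulv) huv; rewrite hC; exact: search_op_perm.
apply: (main); apply: (mulv); first exact: walk_op_perm.
by move=> j; rewrite !mxE.
Qed.

End Symmetry.

(** * The number of oracle calls *)

Section Bounds.
Context {R : realType}.

Lemma cos_ge_34 (y : R) : 0 <= y <= 1 / 2 -> 3 / 4 <= cos y.
Proof.
move=> /andP[y0 y1]; have pi2 := @pi_ge2 R.
have c0 : 0 <= cos y by apply: cos_ge0_pihalf; apply/andP; split; lra.
have s0 : 0 <= sin y by apply: sin_ge0_pi; apply/andP; split; lra.
have sy := sin_le_id y0; have := cos2Dsin2 y.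
move: c0 s0 sy; move: (cos y) (sin y) => c s; nra.
Qed.

(** The imaginary part alone contributes [sin y >= y / 2]. *)
Lemma norm_1Bexpi (y : R) : 0 <= y <= 1 / 2 ->
  (y / 2)%:C <= `|1 - expi (- y)|.
Proof.
move=> /andP[y0 y1]; have pi2 := @pi_ge2 R.
have sy : y <= 2 * sin y by apply: le_2sin; apply/andP; split; lra.
rewrite normc_def lecR /expi cosN sinN /= opprK add0r.
rewrite -[X in X <= _]ger0_norm; last lra.
rewrite -sqrtr_sqr ler_wsqrtr //.
have := sqr_ge0 (1 - cos y).
have : (y / 2) ^+ 2 <= sin y ^+ 2 by rewrite ler_pXn2r ?nnegrE //; lra.
by move: (sin y ^+ 2) (_ ^+ 2) => p q; lra.
Qed.

Lemma norm_prod_1B (q : R) (s : seq R[i]) : 0 <= q ->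
  (forall z, z \in s -> q%:C <= `|1 - z|) ->
  (q ^+ size s)%:C <= `|\prod_(z <- s) (1 - z)|.
Proof.
move=> q0; elim: s => [|z s ih] h; first by rewrite big_nil normr1.
rewrite big_cons normrM /= exprS rmorphM; apply: ler_pM.
- by rewrite ler0c.
- by rewrite ler0c exprn_ge0.
- by apply: h; rewrite mem_head.
- by apply: ih => w hw; apply: h; rewrite inE hw orbT.
Qed.

Lemma jeig_le n k l : (l <= k)%N -> (jeig n l <= k * n.+1)%N.
Proof. by move=> lk; rewrite /jeig; apply: leq_mul => //; exact: leq_subr. Qed.

(** With [n = k + q], [n + 1 - l >= q + 1], and [(k + 1) (q + 1) >= k + q + 1]. *)
Lemma jeig_ge n k l : (k <= n)%N -> l \in iota 1 k -> (n.+1 <= k.+1 * jeig n l)%N.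
Proof.
rewrite mem_iota /jeig => kn /andP[l1 lk].
apply: (@leq_trans (k.+1 * (n.+1 - l))); last first.
  by rewrite leq_mul2l leq_pmull.
have [q hq] : exists q, n = (k + q)%N by exists (n - k)%N; lia.
have : (q.+1 <= n.+1 - l)%N by lia.
move: (n.+1 - l)%N => p; rewrite hq; nia.
Qed.

End Bounds.

(** * Assembly of the search algorithm *)

Lemma card_jvertex n k : jN n k = 'C(n, k).
Proof.
rewrite card_sig -[in RHS](card_ord n) -card_draws.
by apply: eq_card => A; rewrite !inE.
Qed.

Lemma search_runE (R : realType) n k (t0 : R) ps (m : jvertex n k) :
  search_run t0 ps m =
  run (@walk_op R n k) (rot (ket (enum_rank m))) t0 ps (unif_state _).
Proof.
have e : search_op (enum_rank m) = @rot R _ (ket (enum_rank m)).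
  by apply/funext => a; exact: search_opE.
by rewrite /search_run e.
Qed.

(** Here the parameters may still depend on [m]. The base [72 k (k + 1)] is [18 / q]: a factor [18]
    per peeling step, and the lower bound [q = 1 / (4 k (k + 1))] for each [|1 - z_l|]. *)
Lemma search_cost (R : realType) (n k : nat) : (0 < k)%N -> (k <= n)%N ->
  forall m : jvertex n k, exists (t0 : R) ps (phi : R[i]),
    [/\ (size ps)%:R <= (72 * k%:R * k.+1%:R : R) ^+ k * Num.sqrt ('C(n, k))%:R,
        `|phi| = 1 & search_run t0 ps m = phi *: ket (enum_rank m)].
Proof.
move=> k0 kn m.
have [Q [d [QQ LE dk]]] := @laplacian_spectral R n k k0 kn.
(* As [jeig n l <= k (n + 1)], all angles stay within [1 / 2]; by [jeig_ge] those with [l >= 1] are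
   at least [1 / (2 k (k + 1))]. *)
pose t : R := 1 / (2 * k%:R * n.+1%:R).
have kR : 0 < k%:R :> R by rewrite ltr0n.
have k1R : 0 < k.+1%:R :> R by rewrite ltr0n.
have nR : 0 < n.+1%:R :> R by rewrite ltr0n.
have t_small l : (l <= k)%N -> 0 <= t * (jeig n l)%:R <= 1 / 2.
  move=> lk; apply/andP; split; first by rewrite mulr_ge0 // divr_ge0 // !mulr_ge0.
  rewrite /t mulrAC ler_pdivrMr ?mulr_gt0 // mul1r.
  have : (jeig n l)%:R <= (k * n.+1)%:R :> R by rewrite ler_nat jeig_le.
  by rewrite natrM; lra.
have t_large l : l \in iota 1 k -> 1 / (2 * k%:R * k.+1%:R) <= t * (jeig n l)%:R.
  move=> lk.
  rewrite (_ : t * _ = (jeig n l)%:R / (2 * k%:R * n.+1%:R)); last first.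
    by rewrite /t mul1r mulrC.
  rewrite ler_pdivlMr ?mulr_gt0 // mulrAC ler_pdivrMr ?mulr_gt0 //.
  rewrite !mul1r.
  have : n.+1%:R <= (k.+1 * jeig n l)%:R :> R by rewrite ler_nat jeig_ge.
  rewrite natrM; move: (jeig n l)%:R => x h.
  rewrite [leRHS](_ : _ = 2 * k%:R * (k.+1%:R * x)); last by ring.
  by rewrite ler_wpM2l ?mulr_ge0.
have N_bin := card_jvertex n k.
set N := jN n k in N_bin *; rewrite -N_bin.
have N0 : (0 < N)%N by rewrite N_bin bin_gt0.
have NR : 0 < N%:R :> R by rewrite ltr0n.
set sN := Num.sqrt (N%:R : R).
have sN0 : 0 < sN by rewrite sqrtr_gt0.
have sN2 : sN ^+ 2 = N%:R by rewrite sqr_sqrtr // ltW.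
pose zs := peel_phases n k t : seq R[i]; pose A := \prod_(z <- zs) (1 - z).
have size_zs : size zs = k by rewrite size_map size_iota.
pose q : R := 1 / (4 * k%:R * k.+1%:R).
have q0 : 0 < q by rewrite divr_gt0 ?mulr_gt0.
have A_ge : (q ^+ k)%:C <= `|A|.
  rewrite -size_zs; apply: norm_prod_1B; first exact: ltW.
  move=> z /mapP[l lk ->]; apply: le_trans (norm_1Bexpi _); last first.
    by apply: t_small; move: lk; rewrite mem_iota; lia.
  rewrite lecR; have := t_large l lk.
  rewrite (_ : q = 1 / (2 * k%:R * k.+1%:R) / 2).
    by move=> h; apply: ler_wpM2r => //; rewrite invr_ge0.
  by rewrite /q; move: kR k1R; move: (k%:R) (k.+1%:R) => u v u0 v0; field;
      rewrite ?gt_eqF // ?gt_eqF.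
have [a aE] : exists a : R, `|A| = a%:C.
  by exists (Num.sqrt (complex.Re A ^+ 2 + complex.Im A ^+ 2)); rewrite normc_def.
have a_ge : q ^+ k <= a by move: A_ge; rewrite aE lecR.
have a0 : 0 < a by apply: lt_le_trans a_ge; rewrite exprn_gt0.
pose W := @walk_op R n k; pose mk : 'cV[R[i]]_N := ket (enum_rank m).
have Wu : forall s, W s *m adjmx (W s) = 1%:M by exact: (walk_op_unitary QQ LE).
have Wa : forall s, adjmx (W s) = W (- s) by exact: (adj_walk_op QQ LE).
have mm : dot mk mk = 1 by exact: dot_ket1.
have near1 x (xx : dot x x = 1) : 1 / 2 < complex.Re (dot x (W t *m x)) ^+ 2 +
    complex.Im (dot x (W t *m x)) ^+ 2.
  apply: (walk_op_near1 QQ LE) xx => j; apply: cos_ge_34; exact: t_small.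
have zs1 : all (fun z => `|z| == 1) zs.
  by apply/allP => z /mapP[l _ ->]; rewrite norm_expi.
have peelE : peel W t zs mk = (A / sN%:C) *: unif_state N.
  rewrite /W /mk /zs (peel_ket k0 kn QQ LE dk) -/zs -/A /unif_state.
  apply/colP => j; rewrite !mxE -/sN -/N -(rmorph_nat (real_complex R)) -sN2.
  rewrite mulr1 fmorphV rmorphXn /=; field.
  by rewrite (inj_eq (@complexI R) sN 0) gt_eqF.
have uu : dot (unif_state N) (unif_state N) = 1 :> R[i].
  rewrite dotE; under eq_bigr do rewrite !mxE conjCR -rmorphM.
  rewrite sumr_const card_ord -rmorphMn /= -/sN -mulr_natl -sN2.
  by rewrite (_ : _ * _ = 1) //; field; rewrite gt_eqF.
have hD : dot (peel W t zs mk) (peel W t zs mk) = ((a / sN) ^+ 2)%:C.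
  rewrite peelE dotZl dotZr uu mulr1 mulJ normrM normfV aE normCR ger0_norm ?ltW //.
  by rewrite -fmorphV -rmorphM -rmorphXn.
have [c hc cle] := reach_peel Wu Wa mm near1 zs1 hD (divr_gt0 a0 sN0).
have [B wB [y y1 hy]] := hc.
have [t0 [ps [psc hps]]] :=
  word_run (walk_opD QQ LE) (walk_op0 QQ LE) wB.
(* The normalized peeled vector is the uniform state times the phase [x] of [A], which goes into the
   global phase. *)
pose x := A / a%:C.
have aC0 : a%:C != 0 :> R[i] by rewrite (inj_eq (@complexI R) a 0) gt_eqF.
have x1 : `|x| = 1.
  by rewrite normrM normfV aE normCR ger0_norm ?divff // ltW.
have x0 : x != 0 by rewrite -normr_eq0 x1 oner_eq0.
have BE : B *m unif_state N = (y / x) *: mk.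
  move: hy; rewrite peelE scalerA (_ : ((a / sN)^-1)%:C * (A / sN%:C) = x); last first.
    have sC0 : sN%:C != 0 :> R[i] by rewrite (inj_eq (@complexI R) sN 0) gt_eqF.
    have -> : ((a / sN)^-1)%:C = sN%:C / a%:C :> R[i].
      apply: (mulIf aC0); rewrite divfK // -rmorphM; congr (_%:C).
      by field; rewrite !gt_eqF.
    by rewrite mulrC mulrA divfK.
  rewrite -scalemxAr => h.
  by rewrite mulrC -scalerA -h scalerA mulVf // scale1r.
exists t0, ps, (y / x); split.
- rewrite psc; apply: (@le_trans _ _ (2 * c + 1)%:R).
    by rewrite ler_nat mul2n -addnn -addnA leq_addr.
  apply: le_trans cle _; rewrite size_zs invf_div mulrA mulrAC ler_wpM2r ?(ltW sN0) //.
  have -> : 72 * k%:R * k.+1%:R = 18 / q.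
    by rewrite /q; move: kR k1R; move: (k%:R) (k.+1%:R) => u v u0 v0; field;
      rewrite ?gt_eqF // ?gt_eqF.
  rewrite expr_div_n ler_wpM2l ?exprn_ge0 // lef_pV2 ?posrE //.
  by rewrite exprn_gt0.
- by rewrite normrM normfV y1 x1 divr1.
- by rewrite search_runE -/mk -/W -hps.
Qed.

Theorem theorem2 (R : realType) (k : nat) : (0 < k)%N ->
  exists C : R, 0 < C /\
  forall n : nat,
    exists (t0 : R) (ps : seq (R * R)),
      (size ps)%:R <= C * Num.sqrt ('C(n, k))%:R /\
      forall m : jvertex n k,
        exists phi : R[i], `|phi| = 1 /\
          search_run t0 ps m = phi *: ket (enum_rank m).
Proof.
move=> k0; exists ((72 * k%:R * k.+1%:R) ^+ k); split.
  by rewrite exprn_gt0 // !mulr_gt0 // ltr0n.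
move=> n; have [kn|nk] := leqP k n; last first.
  (* For [n < k] there are no vertices and the bound is [0], so the run makes no oracle call. *)
  exists 0, [::]; split; first by rewrite bin_small // sqrtr0 mulr0.
  move=> [A /= hA]; have := max_card (mem A).
  by rewrite (eqP hA) card_ord leqNgt nk.
(* The parameters are found for one vertex [m0] and carried to [m] by a permutation mapping [m0]
   onto [m]. *)
have /card_gt0P[m0 _] : (0 < jN n k)%N by rewrite card_jvertex bin_gt0.
have [t0 [ps [phi [cost phi1 run0]]]] := @search_cost R n k k0 kn m0.
exists t0, ps; split => // m; exists phi; split => //.
have [s hs] : exists s : {perm 'I_n}, forall x, (s x \in val m) = (x \in val m0).
  by apply: perm_mapping; rewrite (eqP (valP m)) (eqP (valP m0)).
have sm : permv s m0 = m.
  apply: val_inj; apply/eqP; rewrite /= eqEcard; apply/andP; split.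
    by apply/fintype.subsetP => x /imsetP[z hz ->]; rewrite hs.
  by rewrite (eqP (valP m)) (eqP (card_perm_vertex s m0)).
apply/colP => i; have [g gK Kg] := injF_bij (@permi_inj n k s).
rewrite -(Kg i) -[in LHS]sm search_run_perm run0 !mxE !andbT.
have -> : enum_rank m = permi s (enum_rank m0) by rewrite /permi enum_rankK sm.
by rewrite (inj_eq (@permi_inj n k s)).
Qed.
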